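(* Let $n,p$ be integers with $0<p\le n-p$, let $\mu=(\mu_1,\ldots,\mu_d)\vdash n$ be a partition with $d=\ell(\mu)$ parts, all of which satisfy $\mu_i\ge p+1$, and let $g\ge 0$ be an integer. Then $$\frac{B^g_{p,n}(\mu)}{|\mathcal{C}_{[p,n-p]}|\cdot|\mathcal{C}_\mu|}=\sum_{k=0}^{2g}\frac{(-1)^k\,c(n-d-2g+k,\;n-d-2g)}{(n-d-2g+k)!}\,W_{n,n-d-2g+k},$$ and, as polynomials in $x$, $$\binom{n}{p}P^{\bullet}_{[p,n-p],\mu}(x)=[y^{n-p}]\;\mathcal{V}_\mu(y)\sum_{i=0}^{p-1}\binom{x+i}{p}(1+y)^{x+i-p},$$ where $$W_{n,r}=\frac{p!\,(n-p)!}{n!}\,[y^{n-p}]\;\mathcal{V}_\mu(y)\sum_{a\ge r-p}y^a\binom{p+a}{a}\binom{p}{p+a-r+1}$$ (the sum being over integers $a\ge \max(0,r-p)$).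
   Context: $\mathfrak{S}_n$ is the symmetric group on $[n]=\{1,\ldots,n\}$. For a partition $\lambda\vdash n$, $\ell(\lambda)$ is its number of parts and $\mathcal{C}_\lambda\subset\mathfrak{S}_n$ is the conjugacy class of permutations of cycle-type $\lambda$; $[p,n-p]$ denotes the partition of $n$ with the two parts $p$ and $n-p$. $\kappa(\pi)$ is the number of cycles of $\pi$ (fixed points included). A connected (labeled, rooted) bicolored map with $n$ edges is a triple $(\alpha,\beta,\gamma)$ of permutations in $\mathfrak{S}_n$ with $\gamma=\alpha\beta$ such that the group generated by $\alpha,\beta$ acts transitively on $[n]$; cycles of $\alpha,\beta,\gamma$ encode white vertices, black vertices and faces respectively. Its genus $g$ is defined by $\kappa(\alpha)+\kappa(\beta)-n+\kappa(\gamma)=2-2g$. $B^g_{p,n}(\mu)$ is the number of connected bicolored maps of genus $g$ with $\gamma$ of cycle-type $[p,n-p]$ and $\alpha$ of cycle-type $\mu$; equivalently, the number of pairs $(\alpha,\gamma)\in\mathcal{C}_\mu\times\mathcal{C}_{[p,n-p]}$ generating a transitive group with $\kappa(\alpha\gamma)=n-\ell(\mu)-2g$. For a fixed permutation $\gamma$ of cycle-type $[p,n-p]$, $$P^{\bullet}_{[p,n-p],\mu}(x)=\frac{1}{|\mathcal{C}_\mu|}\sum_{\alpha\in\mathcal{C}_\mu,\ \langle\alpha,\gamma\rangle\text{ transitive}}x^{\kappa(\alpha\gamma)}=\sum_{g\ge0}\frac{B^g_{p,n}(\mu)}{|\mathcal{C}_\mu|\cdot|\mathcal{C}_{[p,n-p]}|}x^{n-\ell(\mu)-2g}.$$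 (It does not depend on the choice of $\gamma$.) $\mathcal{V}_\mu(y)=\prod_{i=1}^d\{(1+y)^{\mu_i}-1\}$. $[y^m]f(y)$ is the coefficient of $y^m$ in the power series $f(y)$. $c(n,k)$ is the signless Stirling number of the first kind (the number of permutations in $\mathfrak{S}_n$ with exactly $k$ cycles). $\binom{x}{m}=x(x-1)\cdots(x-m+1)/m!$ is a polynomial in $x$, $(1+y)^{x+c}=\sum_{m\ge0}\binom{x+c}{m}y^m$, and $\binom{p}{b}=0$ for $b<0$ or $b>p$. Terms with a negative integer argument in the Stirling number or in the factorial are interpreted as $0$, and $c(0,0)=1$. *)

(* Defs.v *)
From mathcomp Require Import all_boot all_order all_algebra all_fingroup.

Set Implicit Arguments.
Unset Strict Implicit.
Unset Printing Implicit Defensive.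

Import GRing.Theory Num.Theory.

Local Open Scope ring_scope.

Definition is_partition (n : nat) (mu : seq nat) : bool :=
  [&& sorted geq mu, all (leq 1) mu & sumn mu == n].

Definition ncycles (n : nat) (s : 'S_n) : nat := #|porbits s|.

Definition cycle_class (n : nat) (lambda : seq nat) : {set 'S_n} :=
  [set s : 'S_n | perm_eq [seq #|C| | C : {set 'I_n} in porbits s] lambda].

Definition generate_transitive (n : nat) (a b : 'S_n) : bool :=
  [transitive <<[set a; b]>>%g, on [set: 'I_n] | 'P].

Definition bicolored_map (n : nat) (m : 'S_n * 'S_n * 'S_n) : bool :=
  let: (alpha, beta, gamma) := m in
  (gamma == (alpha * beta)%g) && generate_transitive alpha beta.

Definition has_genus (n : nat) (m : 'S_n * 'S_n * 'S_n) (g : nat) : bool :=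
  let: (alpha, beta, gamma) := m in
  (ncycles alpha)%:Z + (ncycles beta)%:Z - n%:Z + (ncycles gamma)%:Z
    == 2 - 2 * g%:Z.

Definition num_maps (g p n : nat) (mu : seq nat) : nat :=
  #|[set m : 'S_n * 'S_n * 'S_n |
      [&& bicolored_map m, has_genus m g,
          m.2 \in cycle_class n [:: p; (n - p)%N]
        & m.1.1 \in cycle_class n mu]]|.

Definition P_conn (n : nat) (gamma : 'S_n) (mu : seq nat) : {poly rat} :=
  (#|cycle_class n mu|%:R)^-1 *:
    \sum_(alpha in cycle_class n mu | generate_transitive alpha gamma)
      'X^(ncycles (alpha * gamma)%g).

(* A formal power series in y over A is its coefficient function nat -> A;
   applying it to m is [y^m]. *)
Definition fps_mul (A : pzRingType) (f h : nat -> A) : nat -> A :=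
  fun m => \sum_(j < m.+1) f j * h (m - j)%N.

Definition calV (A : nzRingType) (mu : seq nat) : nat -> A :=
  fun m => (\prod_(mi <- mu) ((1 + 'X) ^+ mi - 1) : {poly A})`_m.

(* The binomial coefficient of x + c over m, as a polynomial in x = 'X. *)
Definition binom_shift (c : int) (m : nat) : {poly rat} :=
  (m`!%:R)^-1 *: \prod_(j < m) ('X + c%:~R - j%:R).

(* The series (1 + y)^(x + c) in y, with coefficients polynomials in x. *)
Definition pow_shift (c : int) : nat -> {poly rat} := fun m => binom_shift c m.

Definition stirling1 (n k : nat) : nat := #|[set s : 'S_n | ncycles s == k]|.

(* Integer-argument versions, encoding the zero conventions; since 0^-1 = 0
   in rat, factz also makes terms with a negative factorial vanish when it
   occurs in a denominator. *)
Definition stirling1z (m k : int) : nat :=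
  match m, k with Posz m', Posz k' => stirling1 m' k' | _, _ => 0%N end.

Definition factz (m : int) : nat := if m is Posz m' then m'`! else 0%N.

Definition binz (p : nat) (b : int) : nat :=
  if b is Posz b' then 'C(p, b') else 0%N.

Definition W (p n : nat) (mu : seq nat) (r : int) : rat :=
  (p`!%:R * (n - p)`!%:R) / n`!%:R *
  fps_mul (calV rat mu)
    (fun a => if r - p%:Z <= a%:Z
              then 'C(p + a, a)%:R * (binz p (p%:Z + a%:Z - r + 1))%:R
              else 0)
    (n - p)%N.

(* Main.v *)
Require Import Defs.
From mathcomp Require Import all_boot all_order all_algebra all_fingroup.
From mathcomp Require Import ring zify.

Set Implicit Arguments.
Unset Strict Implicit.
Unset Printing Implicit Defensive.

Import GRing.Theory Num.Theory.

Local Open Scope ring_scope.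

(** The statement averages [x ^ kappa(alpha gamma)] over [alpha] of type [mu], for a fixed
    [gamma] with two cycles of lengths [p] and [m = n - p]. Transitivity is automatic: a set
    stable under [alpha] and [gamma] that is neither empty nor full would be a single cycle of
    [gamma], hence its complement or itself would be the [p]-cycle, which is too short to contain
    a cycle of [alpha] ([automatic_transitivity]). By conjugation invariance the average may be
    taken over [gamma] instead, with [alpha] fixed ([class_sum]); that average is computed for
    permutations [alpha] with arbitrary cycle lengths.

    Deleting a point [o] from the [gamma]s that move it writes [gamma] as [gamma' (b o)] with
    [gamma'] fixing [o], so that a sum over [gamma] becomes a sum over [b] of the same kind of sum
    for the permutation [alpha (b o)] with [o] deleted ([sum_two_cycles_step]). Multiplying by
    [(b o)] cuts the cycle of [o] in [alpha] or glues it to another cycle, so only the cycle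
    lengths of [alpha] matter, and they obey a recursion ([insertion_rec_value]) similar to the
    one for products of Jucys-Murphy elements.

    This recursion is solved by colour sums: each cycle of [alpha] receives one of finitely many
    colours, with a sign, and the summand depends only on the total length received by each
    colour. The recursion acts on a colour sum through its coefficient function alone
    ([insertion_sum_colour_sum]), which leaves identities between binomial coefficients. For
    [gamma] a single [n]-cycle two colours suffice and the coefficient is
    [binom(x + n_true, n + 1)] ([one_cycle_closed_form]). For two cycles there
    are four colours, a sign for each of a small and a big kind, and the coefficient
    [two_cycle_coef] vanishes as soon as the small colours receive more than [p] in total. The
    closed form [two_cycle_closed_form] is proved by induction on [p]: inserting a point in one
    of the two cycles relates the numbers for [(p, m)] and [(p + 1, m - 1)]
    ([two_cycle_gf_rec]). The binomial identity behind it, [kernel_identity], has a telescoping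
    certificate.

    If all parts of [mu] exceed [p], no part can be given a small colour. The two remaining
    colours contribute [(1 + y)^mu_i] and [-1] for each part, which is [V_mu(y)], and the
    coefficient function at this point is the sum over [i < p] of the second formula
    ([two_cycle_coef_calV], [P_conn_formula]).

    For the first formula, that sum is expanded on the binomial basis [binom(x, r)] by
    Vandermonde's identity ([sum_kernel_gbin]); the coefficients are the numbers [W]
    ([W_expansion]). The number of maps of genus [g] is the coefficient of [x^(n - d - 2g)],
    and the coefficients of [binom(x, r)] are signed Stirling numbers over [r!]
    ([coef_binom_shift0]). *)

(** * Generalised binomial coefficients *)

Definition gbin (r : rat) (m : nat) : rat := (\prod_(j < m) (r - j%:R)) / m`!%:R.

Lemma natS_neq0 m : (m.+1%:R : rat) != 0.
Proof. by rewrite pnatr_eq0. Qed.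

Lemma fact_neq0 m : (m`!%:R : rat) != 0.
Proof. by rewrite pnatr_eq0 -lt0n fact_gt0. Qed.

Lemma gbin0 r : gbin r 0 = 1.
Proof. by rewrite /gbin big_ord0 divr1. Qed.

Lemma gbinSr r m : gbin r m.+1 = gbin r m * (r - m%:R) / m.+1%:R.
Proof.
rewrite /gbin big_ord_recr /= factS natrM invfM.
by ring.
Qed.

Lemma gbinSl r m : gbin r m.+1 = r * gbin (r - 1) m / m.+1%:R.
Proof.
rewrite /gbin big_ord_recl /= factS natrM invfM subr0.
rewrite (eq_bigr (fun j : 'I_m => r - 1 - j%:R)); last first.
  by move=> j _; rewrite /bump /= natrD opprD addrA.
by ring.
Qed.

Lemma gbin_pascal r m : gbin (r + 1) m.+1 = gbin r m.+1 + gbin r m.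
Proof.
rewrite gbinSl addrK gbinSr.
have := natS_neq0 m; rewrite -natr1 => h; by field.
Qed.

(** * Colour sums and the insertion recursion *)

Definition picks (T : Type) : seq T -> seq (T * seq T) :=
  fix F s := if s is k :: r then (k, r) :: [seq (q.1, k :: q.2) | q <- F r] else [::].

Section Recursion.

Variable x : rat.

(** The effect of deleting a point of a cycle of length [k], the other cycle lengths being
    [r]. The three terms collect the points [b] for which [alpha (b o)] fixes [o], those for
    which the cycle of [o] is cut in two, and those in another cycle, which is then glued to
    it. The weight [x] counts the lost fixed point. *)
Definition insertion_rec (h : seq nat -> rat) (k : nat) (r : seq nat) : rat :=
  x * h (k.-1 :: r) + \sum_(1 <= i < k.-1) h [:: i, (k.-1 - i)%N & r]
  + \sum_(q <- picks r) q.1%:R * h ((k + q.1).-1 :: q.2).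

(** A cycle of length [k] contains [k] points to delete. *)
Definition insertion_sum (h : seq nat -> rat) (mu : seq nat) : rat :=
  \sum_(q <- picks mu) q.1%:R * insertion_rec h q.1 q.2.

Variables (J : finType) (e : J -> rat).
Hypothesis e2 : forall j, e j * e j = 1.
Hypothesis e0 : \sum_j e j = 0.

Local Notation sizes := {ffun J -> nat}.
Definition add_size (n : sizes) j k : sizes := [ffun i => (n i + (i == j) * k)%N].
Definition shift_size j k (c : sizes -> rat) : sizes -> rat := fun n => c (add_size n j k).

(** Every part of [mu] is given a colour [j] in [J] with sign [e j]; [c] is evaluated at the
    vector of the total sizes received by the colours. The recursion shifts the argument of
    [c] instead of carrying that vector. *)
Fixpoint colour_sum (c : sizes -> rat) (mu : seq nat) : rat :=
  if mu is k :: r then \sum_j e j * colour_sum (shift_size j k c) r else c [ffun=> 0%N].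

Lemma colour_sumS c k r : colour_sum c (k :: r) = \sum_j e j * colour_sum (shift_size j k c) r.
Proof. by []. Qed.

Arguments colour_sum : simpl never.

Lemma add_size0 n j : add_size n j 0 = n.
Proof. by apply/ffunP=> i; rewrite ffunE muln0 addn0. Qed.

Lemma add_sizeAC n i k j l : add_size (add_size n i k) j l = add_size (add_size n j l) i k.
Proof. by apply/ffunP=> z; rewrite !ffunE addnAC. Qed.

Lemma add_sizeD n i k l : add_size (add_size n i k) i l = add_size n i (k + l).
Proof. by apply/ffunP=> z; rewrite !ffunE -addnA mulnDr. Qed.

Lemma eq_colour_sum c d mu : c =1 d -> colour_sum c mu = colour_sum d mu.
Proof.
elim: mu c d => [|k r IH] c d ecd; first exact: ecd.
by rewrite !colour_sumS; apply: eq_bigr => j _; congr (_ * _); apply: IH => n; apply: ecd.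
Qed.

Lemma sum_add_size (n : sizes) j k : (\sum_i add_size n j k i = \sum_i n i + k)%N.
Proof.
under eq_bigr do rewrite ffunE.
rewrite big_split /=; congr addn.
by rewrite (bigD1 j) //= eqxx mul1n big1 ?addn0 // => i /negPf->.
Qed.

(** The sizes of the colours always add up to [sumn mu], so coefficient functions need only
    be compared there. *)
Lemma eq_colour_sum_total c d mu :
  (forall n : sizes, (\sum_j n j)%N = sumn mu -> c n = d n) -> colour_sum c mu = colour_sum d mu.
Proof.
elim: mu c d => [|k r IH] c d ecd.
  by apply: ecd; rewrite big1 // => j _; rewrite ffunE.
rewrite !colour_sumS; apply: eq_bigr => j _; congr (_ * _); apply: IH => n en.
by apply: ecd; rewrite sum_add_size en /= addnC.
Qed.

Lemma colour_sumD c d mu : colour_sum (fun n => c n + d n) mu = colour_sum c mu + colour_sum d mu.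
Proof.
elim: mu c d => [|k r IH] c d //.
by rewrite !colour_sumS -big_split /=; apply: eq_bigr => j _; rewrite -mulrDr -IH.
Qed.

Lemma colour_sumZ a c mu : colour_sum (fun n => a * c n) mu = a * colour_sum c mu.
Proof.
elim: mu c => [|k r IH] c //.
rewrite !colour_sumS mulr_sumr; apply: eq_bigr => j _; rewrite mulrCA; congr (_ * _).
exact: IH.
Qed.

Lemma colour_sum0 mu : colour_sum (fun=> 0) mu = 0.
Proof.
elim: mu => [|k r IH] //; rewrite colour_sumS big1 // => j _.
by rewrite (eq_colour_sum (d := fun=> 0)) ?IH ?mulr0.
Qed.

Lemma colour_sum_big (I : Type) (s : seq I) (P : pred I) (c : I -> sizes -> rat) mu :
  colour_sum (fun n => \sum_(i <- s | P i) c i n) mu = \sum_(i <- s | P i) colour_sum (c i) mu.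
Proof.
elim: s => [|a s IH].
  by rewrite big_nil -[RHS](colour_sum0 mu); apply: eq_colour_sum => n; rewrite big_nil.
rewrite big_cons; case Pa: (P a).
  by rewrite -IH -colour_sumD; apply: eq_colour_sum => n; rewrite big_cons Pa.
by rewrite -IH; apply: eq_colour_sum => n; rewrite big_cons Pa.
Qed.

Lemma colour_sum_swap c k l r : colour_sum c [:: k, l & r] = colour_sum c [:: l, k & r].
Proof.
rewrite !colour_sumS.
under eq_bigr do rewrite colour_sumS mulr_sumr.
under [RHS]eq_bigr do rewrite colour_sumS mulr_sumr.
rewrite exchange_big /=; apply: eq_bigr => i _; apply: eq_bigr => j _.
rewrite mulrCA; congr (_ * (_ * _)); apply: eq_colour_sum => n.
by rewrite /shift_size add_sizeAC.
Qed.

Lemma eq_colour_sum_cons k r s : (forall c, colour_sum c r = colour_sum c s) ->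
  forall c, colour_sum c (k :: r) = colour_sum c (k :: s).
Proof. by move=> h c; rewrite !colour_sumS; apply: eq_bigr => j _; rewrite h. Qed.

Lemma colour_sum_mid c s k r : colour_sum c (s ++ k :: r) = colour_sum c (k :: s ++ r).
Proof.
elim: s c => [|l s IH] c //.
by rewrite cat_cons (eq_colour_sum_cons _ IH) colour_sum_swap.
Qed.

Lemma colour_sum_perm c s t : perm_eq s t -> colour_sum c s = colour_sum c t.
Proof.
elim: s t c => [|k s IH] t c; first by rewrite perm_sym => /perm_nilP->.
move=> pst; have kt: k \in t by rewrite -(perm_mem pst) mem_head.
case/splitPr: kt pst => t1 t2; rewrite perm_sym perm_catC /= perm_cons perm_catC.
rewrite perm_sym => /IH h; rewrite colour_sum_mid; exact: eq_colour_sum_cons.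
Qed.

(** A part of size 0 changes no total size, and the signs of its colours cancel. *)
Lemma colour_sum_part0 c r : colour_sum c (0 :: r) = 0.
Proof.
rewrite colour_sumS (eq_bigr (fun j => e j * colour_sum c r)).
  by rewrite -mulr_suml e0 mul0r.
by move=> j _; congr (_ * _); apply: eq_colour_sum => n; rewrite /shift_size add_size0.
Qed.

(** The total size of colour [j] is the sum of the sizes of the parts that have this colour. *)
Lemma colour_sum_weight j c r :
  \sum_(q <- picks r) q.1%:R * colour_sum (shift_size j q.1 c) q.2 =
  e j * colour_sum (fun n => (n j)%:R * c n) r.
Proof.
elim: r c => [|k r IH] c.
  by rewrite big_nil /colour_sum ffunE mul0r mulr0.
rewrite big_cons big_map colour_sumS /=.
have E i : colour_sum (shift_size i k (fun n => (n j)%:R * c n)) r =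
   colour_sum (fun n => (n j)%:R * shift_size i k c n) r + (i == j)%:R * k%:R * colour_sum
     (shift_size j k c) r.
  rewrite -colour_sumZ -colour_sumD; apply: eq_colour_sum => n;
    rewrite /shift_size ffunE natrD mulrDl.
  congr (_ + _); rewrite natrM eq_sym; case: eqP => [->|_] //.
  by rewrite !mul0r.
under [X in _ = _ * X]eq_bigr do rewrite E mulrDr.
rewrite big_split mulrDr /= addrC; congr (_ + _).
  under eq_bigr do rewrite colour_sumS mulr_sumr.
  rewrite exchange_big mulr_sumr; apply: eq_bigr => i _ /=.
  rewrite mulrCA -IH mulr_sumr; apply: eq_bigr => q _; rewrite ?colour_sumS.
  rewrite mulrCA; congr (_ * (_ * _)); apply: eq_colour_sum => n.
  by rewrite /shift_size add_sizeAC.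
rewrite (bigD1 j) //= eqxx mul1r big1 ?addr0 => [|i /negPf->].
  by rewrite mulrA e2 mul1r.
by rewrite !mul0r mulr0.
Qed.

Definition drop_size (n : sizes) j : sizes := [ffun i => (n i - (i == j))%N].

(** The coefficient function on which the insertion recursion acts. The term with
    [drop_size] collects the lost fixed points, the cuts into two pieces of the same colour
    [j] and the gluings; [g j i] is a primitive of [c] along the move of one unit from [i]
    to [j], and accounts for the cuts whose two pieces have different colours. *)
Definition derived_coef (c : sizes -> rat) (g : J -> J -> sizes -> rat) (n : sizes) : rat :=
  \sum_j (n j)%:R * ((x + e j * (n j)%:R) * c (drop_size n j)
                     + 2 * \sum_(i | i != j) e i * g j i n).

Lemma insertion_rec_cons c l k r : insertion_rec (colour_sum c) l (k :: r) =
  \sum_j e j * insertion_rec (colour_sum (shift_size j k c)) l r + k%:R * colour_sum c ((l +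
    k).-1 :: r).
Proof.
rewrite {1}/insertion_rec [picks _]/= big_cons big_map [(_, _).1]/= [(_, _).2]/=.
rewrite [X in _ + X]addrC addrA; congr (_ + _).
rewrite /insertion_rec.
under [RHS]eq_bigr do rewrite !mulrDr.
rewrite !big_split; congr (_ + _ + _).
- rewrite colour_sum_swap colour_sumS mulr_sumr.
  by apply: eq_bigr => j _; rewrite mulrCA.
- under [RHS]eq_bigr do rewrite mulr_sumr.
  rewrite [RHS]exchange_big; apply: eq_bigr => i _.
  by rewrite -[LHS]/(colour_sum c ([:: i; (l.-1 - i)%N] ++ k :: r)) colour_sum_mid.
- under [RHS]eq_bigr do rewrite mulr_sumr.
  rewrite [RHS]exchange_big; apply: eq_bigr => q _.
  rewrite colour_sum_swap colour_sumS mulr_sumr.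
  by apply: eq_bigr => j _; rewrite mulrCA.
Qed.

(** Induction on the number of parts. For the part [k] being split, the pieces [a] and [k -
    a] of equal colour give [k] equal terms, while for distinct colours [i] and [j] the sum
    over [a] of [c], shifted by [a] in direction [i] and by [k - a] in direction [j],
    telescopes because [c] is a difference of [g i j]. The gluings of [k] to the other parts
    are evaluated by [colour_sum_weight]. *)
Lemma insertion_sum_colour_sum (c : sizes -> rat) (g : J -> J -> sizes -> rat) mu :
  all (leq 1) mu ->
  (forall i j n, i != j -> g i j n = - g j i n) ->
  (forall i j n, i != j -> g i j (add_size n i 1) - g i j (add_size n j 1) = c n) ->
  insertion_sum (colour_sum c) mu = colour_sum (derived_coef c g) mu.
Proof.
elim: mu c g => [|k r IH] c g.
  move=> _ _ _; rewrite /insertion_sum /= big_nil /colour_sum /derived_coef big1 // => j _.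
  by rewrite ffunE mul0r.
move=> /= /andP[k0 r0] ga gt.
rewrite /insertion_sum /= big_cons big_map /=.
under eq_bigr do rewrite insertion_rec_cons mulrDr mulr_sumr.
rewrite big_split /= exchange_big /=.
have -> : \sum_j \sum_(q <- picks r) q.1%:R * (e j * insertion_rec (colour_sum (shift_size j k
  c)) q.1 q.2)
   = \sum_j e j * colour_sum (derived_coef (shift_size j k c) (fun a b => shift_size j k (g a
     b))) r.
  apply: eq_bigr => j _; rewrite -IH //.
  - by rewrite /insertion_sum mulr_sumr; apply: eq_bigr => q _; rewrite mulrCA.
  - by move=> a b n nab; rewrite /shift_size ga.
  - by move=> a b n nab; rewrite /shift_size -!(add_sizeAC _ j k) gt.
case: k k0 => // k _.
have main i n : shift_size i k.+1 (derived_coef c g) n =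
    derived_coef (shift_size i k.+1 c) (fun a b => shift_size i k.+1 (g a b)) n
  + k.+1%:R * (x * shift_size i k c n + e i * k.+1%:R * shift_size i k c n
       + 2 * e i * ((n i)%:R * shift_size i k c n)
       + 2 * \sum_(j | j != i) e j * shift_size i k.+1 (g i j) n).
  rewrite /shift_size /derived_coef (bigD1 i) //= [in RHS](bigD1 i) //=.
  have -> : drop_size (add_size n i k.+1) i = add_size n i k.
    by apply/ffunP=> z; rewrite !ffunE; case: eqP => _ //=;
       rewrite ?mul1n ?mul0n ?addn0 ?subn0 // addnS subn1.
  have -> : \sum_(j | j != i) (add_size n i k.+1 j)%:R *
      ((x + e j * (add_size n i k.+1 j)%:R) * c (drop_size (add_size n i k.+1) j)
        + 2 * \sum_(i0 | i0 != j) e i0 * g j i0 (add_size n i k.+1)) =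
     \sum_(j | j != i) (n j)%:R * ((x + e j * (n j)%:R) * c (add_size (drop_size n j) i k.+1)
        + 2 * \sum_(i0 | i0 != j) e i0 * g j i0 (add_size n i k.+1)).
    apply: eq_bigr => j ji; rewrite {1 2}/add_size ffunE (negPf ji) mul0n addn0.
    congr (_ * (_ * c _ + _)); apply/ffunP=> z; rewrite !ffunE.
    by case: (z =P i) => [->|_] //=; rewrite ?(eq_sym i) ?(negPf ji) ?mul0n ?addn0 ?subn0.
  have nS : ((add_size n i k.+1) i)%:R = (n i)%:R + k.+1%:R :> rat.
    by rewrite ffunE eqxx mul1n natrD.
  rewrite nS; set S := \sum_(_ | _) _; set G := \sum_(_ | _) _; clearbody S G.
  have [n0|n0] := posnP (n i).
    by rewrite n0 !add0r !mul0r; ring: (e2 i).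
  have -> : add_size (drop_size n i) i k.+1 = add_size n i k.
    apply/ffunP=> z; rewrite !ffunE; case: eqP => [->|_] //=; last by rewrite subn0 !mul0n.
    by rewrite !mul1n subn1 -addSnnS prednK.
  by ring.
have -> : \sum_(q <- picks r) q.1%:R * (k.+1%:R * colour_sum c ((q.1 + k.+1).-1 :: q.2)) =
  k.+1%:R * \sum_j colour_sum (fun n => (n j)%:R * shift_size j k c n) r.
  under eq_bigr do rewrite mulrCA.
  rewrite -mulr_sumr; congr (_ * _).
  rewrite [RHS](eq_bigr (fun j => e j * (e j * colour_sum (fun n => (n j)%:R * shift_size j k c
    n) r)));
    last by move=> j _; rewrite mulrA e2 mul1r.
  under [RHS]eq_bigr do rewrite -colour_sum_weight mulr_sumr.
  rewrite exchange_big /=; apply: eq_bigr => q _.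
  rewrite addnS colour_sumS mulr_sumr; apply: eq_bigr => j _.
  rewrite mulrCA; congr (_ * (_ * _)); apply: eq_colour_sum => n.
  by rewrite /shift_size add_sizeD.
rewrite /insertion_rec.
have -> : \sum_(q <- picks r) q.1%:R * colour_sum c ((k.+1 + q.1).-1 :: q.2) =
  \sum_j colour_sum (fun n => (n j)%:R * shift_size j k c n) r.
  rewrite [RHS](eq_bigr (fun j => e j * (e j * colour_sum (fun n => (n j)%:R * shift_size j k c
    n) r)));
    last by move=> j _; rewrite mulrA e2 mul1r.
  under [RHS]eq_bigr do rewrite -colour_sum_weight mulr_sumr.
  rewrite exchange_big /=; apply: eq_bigr => q _.
  rewrite colour_sumS mulr_sumr; apply: eq_bigr => j _.
  rewrite mulrCA; congr (_ * (_ * _)); apply: eq_colour_sum => n.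
  by rewrite /shift_size add_sizeD addnC.
have -> : \sum_(1 <= i < k) colour_sum c [:: i, (k - i)%N & r] =
   k.+1%:R * \sum_j colour_sum (shift_size j k c) r
   + 2 * \sum_j \sum_(i | i != j) e j * e i * colour_sum (shift_size j k.+1 (g j i)) r.
  have -> : \sum_(1 <= i < k) colour_sum c [:: i, (k - i)%N & r] =
            \sum_(0 <= i < k.+1) colour_sum c [:: i, (k - i)%N & r].
    rewrite [RHS]big_ltn // colour_sum_part0 add0r.
    case: (k) => [|k']; first by rewrite !big_geq.
    by rewrite [RHS]big_nat_recr //= subnn -[X in _ + X]/(colour_sum c [:: k'.+1, 0%N & r])
      colour_sum_swap colour_sum_part0 addr0.
  under eq_bigr => a _.
    rewrite colour_sumS.
    under eq_bigr do rewrite colour_sumS mulr_sumr.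
    over.
  rewrite exchange_big /=.
  under eq_bigr do rewrite exchange_big /=.
  under eq_bigr => i _ do rewrite (bigD1 i) //=.
  rewrite big_split /=; congr (_ + _).
    rewrite mulr_sumr; apply: eq_bigr => i _.
    rewrite (eq_big_nat _ _ (F2 := fun=> colour_sum (shift_size i k c) r)).
      by rewrite sumr_const_nat subn0 mulr_natl.
    move=> a /andP[_ ak]; rewrite mulrA e2 mul1r; apply: eq_colour_sum => n.
    by rewrite /shift_size add_sizeD subnK.
  have tel i j : i != j -> \sum_(0 <= a < k.+1) e i * (e j * colour_sum (shift_size j (k - a)
    (shift_size i a c)) r)
     = e i * e j * (colour_sum (shift_size i k.+1 (g i j)) r - colour_sum (shift_size j k.+1 (g i
       j)) r).
    move=> ij.
    pose G a := e i * e j * colour_sum (fun n => g i j (add_size (add_size n i a) j (k.+1 - a))) r.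
    rewrite (eq_big_nat _ _ (F2 := fun a => G a.+1 - G a)).
      rewrite telescope_sumr // /G -mulrBr subnn subn0; congr (_ * (_ - _)).
        by apply: eq_colour_sum => n; rewrite add_size0.
      by apply: eq_colour_sum => n; rewrite add_size0.
    move=> a /andP[_ ak]; rewrite /G -mulrBr mulrA; congr (_ * _).
    rewrite -[X in _ = _ + X]mulN1r -colour_sumZ -colour_sumD; apply: eq_colour_sum => n.
    rewrite mulN1r /shift_size subSS -(gt _ _ _ ij); congr (g i j _ - g i j _).
      by rewrite [RHS]add_sizeAC add_sizeD addn1.
    by rewrite (add_sizeAC _ j) add_sizeD addn1 subSn.
  pose F i j := e i * e j * colour_sum (shift_size i k.+1 (g i j)) r.
  have -> : \sum_i \sum_(j | j != i) \sum_(0 <= a < k.+1)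
      e i * (e j * colour_sum (shift_size j (k - a) (shift_size i a c)) r)
    = \sum_i \sum_(j | j != i) F i j + \sum_i \sum_(j | j != i) F j i.
    rewrite -big_split; apply: eq_bigr => i _; rewrite -big_split.
    apply: eq_bigr => j ji; rewrite tel 1?eq_sym // mulrBr; congr (_ + _).
    rewrite /F -mulrN (mulrC (e i)); congr (_ * _).
    rewrite -mulN1r -colour_sumZ; apply: eq_colour_sum => n.
    by rewrite mulN1r /shift_size (ga j i).
  rewrite [X in _ + X](exchange_big_dep xpredT) //=.
  rewrite [X in _ + X](eq_bigr (fun i => \sum_(j | j != i) F i j)); last first.
    by move=> i _; apply: eq_bigl => j; rewrite eq_sym.
  by rewrite mulr_natl mulr2n.
rewrite [k.+1.-1]/= [RHS]colour_sumS [colour_sum c (k :: r)]colour_sumS.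
rewrite [RHS](eq_bigr (fun j => e j *
     colour_sum (derived_coef (shift_size j k.+1 c) (fun a b => shift_size j k.+1 (g a b))) r
   + k.+1%:R * (x * (e j * colour_sum (shift_size j k c) r) + k.+1%:R * colour_sum (shift_size j
     k c) r
      + 2 * colour_sum (fun n => (n j)%:R * shift_size j k c n) r
      + 2 * \sum_(i | i != j) e j * e i * colour_sum (shift_size j k.+1 (g j i)) r))); last first.
  move=> j _; rewrite (eq_colour_sum _ (main j)) colour_sumD mulrDr; congr (_ + _).
  rewrite colour_sumZ mulrCA; congr (_ * _); rewrite !colour_sumD !colour_sumZ !mulrDr.
  rewrite mulrCA; congr (_ + _ + _ + _).
  - by rewrite !mulrA e2 mul1r.
  - by rewrite [2 * e j]mulrC !mulrA e2 mul1r.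
  - rewrite mulrCA; congr (_ * _); rewrite colour_sum_big mulr_sumr; apply: eq_bigr => i _.
    by rewrite colour_sumZ mulrA.
rewrite [RHS]big_split /= -mulr_sumr !big_split /= -!mulr_sumr.
set S1 := \sum_j e j * colour_sum (derived_coef _ _) r.
set S2 := \sum_j e j * colour_sum (shift_size j k c) r.
set S3 := \sum_j colour_sum (shift_size j k c) r.
set S4 := \sum_j colour_sum _ r.
set S5 := \sum_j \sum_(i | i != j) _.
by move: S1 S2 S3 S4 S5 => S1 S2 S3 S4 S5; ring.
Qed.
End Recursion.
Arguments colour_sum : simpl never.

(** * One cycle: the coefficient function *)

Lemma gbin_absorb r m : r * gbin (r - 1) m = gbin r m * (r - m%:R).
Proof.
have := etrans (esym (gbinSl r m)) (gbinSr r m).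
by move/(congr1 (fun z => z * m.+1%:R)); rewrite !mulfVK ?natS_neq0.
Qed.

Definition sign2 (b : bool) : rat := if b then 1 else -1.

(** For the four colours, the first boolean tells the big kind from the small one and the
    second one is the sign. *)
Definition sign4 (j : bool * bool) : rat := sign2 j.2.

Lemma sign2_sq b : sign2 b * sign2 b = 1.
Proof. by case: b; rewrite /sign2 ?mulr1 ?mulrNN ?mulr1. Qed.

Lemma sign2_sum : \sum_b sign2 b = 0.
Proof. by rewrite big_bool /= subrr. Qed.

Lemma sign4_sq j : sign4 j * sign4 j = 1.
Proof. exact: sign2_sq. Qed.

Lemma sign4_sum : \sum_j sign4 j = 0.
Proof.
rewrite -(pair_bigA _ (fun a b => sign4 (a, b))) big1 //= => a _.
exact: sign2_sum.
Qed.

Section Kernels.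
Variable x : rat.

Definition one_cycle_coef (n : nat) (f : {ffun bool -> nat}) : rat :=
  gbin (x + (f true)%:R) n.+1.

(** The primitive of [binom(x + n_true, n + 1)] along the move of one unit from [false] to
    [true] is the next binomial coefficient, by Pascal's rule. *)
Lemma one_cycle_step n mu : all (leq 1) mu -> sumn mu = n.+1 ->
  insertion_sum x (colour_sum sign2 (one_cycle_coef n)) mu = (n.+1 * n)%:R * colour_sum sign2
    (one_cycle_coef n.+1) mu.
Proof.
move=> mu0 smu.
pose g (i j : bool) f := sign2 i * gbin (x + ((f : {ffun bool -> nat}) true)%:R) n.+2.
rewrite (insertion_sum_colour_sum (g := g) x sign2_sq sign2_sum) //; first last.
- have P (f : {ffun bool -> nat}) : gbin (x + (add_size f true 1 true)%:R) n.+2 - gbin (x +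
    (add_size f false 1 true)%:R) n.+2 = one_cycle_coef n f.
    by rewrite !ffunE /= addn0 natrD addrA gbin_pascal addrAC subrr add0r.
  move=> [] [] f //= _; rewrite /g /sign2 ?mul1r ?mulN1r; first exact: P.
  by rewrite opprK addrC P.
- by move=> [] [] f //= _; rewrite /g /sign2 !mulN1r !mul1r ?opprK.
rewrite -colour_sumZ; apply: eq_colour_sum_total => f.
rewrite big_bool smu /derived_coef big_bool /=.
rewrite !(big_mkcond (fun i => i != _)) !big_bool /= /g /one_cycle_coef /sign2 !ffunE /= !subn0.
case: (f true) (f false) => [|a] b.
  rewrite add0n => ->; rewrite !mulr0n !addr0 (gbinSr x n.+1) natrM.
  have := natS_neq0 n.+1; rewrite -!natr1 => h; by field.
rewrite subn1 /= => /eqP; rewrite addSn eqSS => /eqP abn.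
have -> : b%:R = n%:R - a%:R :> rat by rewrite -abn natrD addrC addKr.
have E := gbin_absorb (x + a.+1%:R) n.+1.
have xa : x + a%:R = x + a.+1%:R - 1 by rewrite -[a.+1%:R]natr1 addrA addrK.
rewrite xa mul1r E (gbinSr (x + a.+1%:R) n.+1) natrM.
have := natS_neq0 n.+1; rewrite -!natr1 => h; by field.
Qed.

End Kernels.

(** * Two cycles: the binomial kernel and its discrete primitives *)

(** [X] and [Z] stand for [x] plus the totals of the positive small and big colours, and [q]
    for what remains of [p] once the total of the small colours is removed. The case [q = 0]
    is not the value of the empty sum: it is what makes [kernel] consistent under the
    discrete differences below. *)
Definition kernel (p m : nat) (X Z : rat) (q : nat) : rat :=
  if q is 0 then gbin X p.+1 * gbin Z m.+1
  else \sum_(0 <= i < q) gbin (X + i%:R) p * gbin (Z + i%:R - q%:R) m.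

(** The functions [prim_ij] are discrete primitives of [kernel], with respect to moving one
    unit from a small colour to a big one. In the names the first letter gives the sign of
    the big colour and the second one that of the small colour, [b] for plus and [f] for
    minus. *)
Definition prim_bb p m (X Z : rat) (q : nat) : rat :=
  gbin (X + q%:R) p.+1 * gbin (Z - 1) m.+1
  - \sum_(0 <= i < q) gbin (X + i%:R) p.+1 * gbin (Z + i%:R - q%:R - 1) m.

Definition prim_ff p m (X Z : rat) (q : nat) : rat :=
  gbin (X + q%:R) p.+1 * gbin Z m.+1
  - \sum_(0 <= i < q) gbin (X + i%:R) p * gbin (Z + i%:R - q%:R) m.+1.

Definition prim_fb p m (X Z : rat) (q : nat) : rat :=
  gbin (X + q%:R) p.+1 * gbin Z m.+1
  + \sum_(0 <= i < q) i.+1%:R * (gbin (X + i%:R) p * gbin (Z + i%:R - q%:R) m).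

Definition prim_bf p m (X Z : rat) (q : nat) : rat :=
  gbin X p.+1 * gbin (Z - q%:R - 1) m.+1
  + \sum_(0 <= i < q) (q%:R - i%:R) * (gbin (X + i%:R) p * gbin (Z + i%:R - q%:R - 1) m).

Lemma kernel_pos p m X Z q : (0 < q)%N ->
  kernel p m X Z q = \sum_(0 <= i < q) gbin (X + i%:R) p * gbin (Z + i%:R - q%:R) m.
Proof. by case: q. Qed.

Lemma gbin_diff r m : gbin (r + 1) m.+1 - gbin r m.+1 = gbin r m.
Proof. by rewrite gbin_pascal addrAC subrr add0r. Qed.

(** Moving one unit between the two small colours raises [X] by 1 and leaves [q] unchanged. *)
Lemma kernel_diffX p m X Z q :
  kernel p.+1 m (X + 1) Z q - kernel p.+1 m X Z q = kernel p m X Z q.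
Proof.
case: q => [|q]; first by rewrite /kernel -mulrBl gbin_diff.
rewrite !kernel_pos // -sumrB; apply: eq_bigr => i _.
by rewrite -mulrBl (addrAC X) gbin_diff.
Qed.

(** Moving one unit between the two big colours raises [Z] by 1. *)
Lemma kernel_diffZ p m X Z q :
  kernel p m.+1 X (Z + 1) q - kernel p m.+1 X Z q = kernel p m X Z q.
Proof.
case: q => [|q]; first by rewrite /kernel -mulrBr gbin_diff.
rewrite !kernel_pos // -sumrB; apply: eq_bigr => i _.
by rewrite -mulrBr (addrAC Z 1) (addrAC _ 1) gbin_diff.
Qed.

(** Moving one unit from a small to a big colour lowers the small total, hence raises [q] by
    1. This lemma and the next three treat the four choices of signs. *)
Lemma prim_bb_diff p m X Z q :
  prim_bb p m X (Z + 1) q.+1 - prim_bb p m (X + 1) Z q = kernel p m X Z q.+1.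
Proof.
rewrite /prim_bb kernel_pos // addrK.
rewrite [X in _ - X - _]big_nat_recr //= [RHS]big_nat_recr //=.
have e : forall i : nat, Z + 1 + i%:R - q.+1%:R - 1 = Z + i%:R - q.+1%:R.
  by move=> i; ring.
under eq_bigr do rewrite e.
rewrite (eq_bigr (fun i : nat => gbin (X + i%:R) p.+1 * gbin (Z + i%:R - q.+1%:R) m + gbin (X +
  i%:R) p * gbin (Z + i%:R - q.+1%:R) m) (r := index_iota 0 q) (F1 := fun i : nat => gbin (X + 1
    + i%:R) p.+1 * gbin (Z + i%:R - q%:R - 1) m)); last first.
  move=> i _; rewrite (addrAC X) gbin_pascal mulrDl.
  have -> : Z + i%:R - q%:R - 1 = Z + i%:R - q.+1%:R by rewrite -natr1; ring.
  by [].
rewrite big_split /=.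
have -> : Z + 1 + q%:R - q.+1%:R - 1 = Z - 1 by rewrite -natr1; ring.
have -> : Z + q%:R - q.+1%:R = Z - 1 by rewrite -natr1; ring.
have -> : X + 1 + q%:R = X + q.+1%:R by rewrite -natr1; ring.
have := gbin_pascal (Z - 1) m; rewrite subrK => ->.
have := gbin_pascal (X + q%:R) p; rewrite -addrA natr1 => ->.
ring.
Qed.

Lemma prim_ff_diff p m X Z q :
  prim_ff p m X Z q.+1 - prim_ff p m X Z q = kernel p m X Z q.+1.
Proof.
rewrite /prim_ff kernel_pos //.
rewrite [X in _ - X - _]big_nat_recr //= [RHS]big_nat_recr //=.
have e (i : nat) : Z + i%:R - q%:R = Z + i%:R - q.+1%:R + 1 by rewrite -natr1; ring.
under [X in _ - (_ - X)]eq_bigr do rewrite e gbin_pascal mulrDr.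
rewrite big_split /=.
have -> : Z + q%:R - q.+1%:R = Z - 1 by rewrite -natr1; ring.
have := gbin_pascal (Z - 1) m; rewrite subrK => ->.
have := gbin_pascal (X + q%:R) p; rewrite -addrA natr1 => ->.
ring.
Qed.

Lemma prim_fb_diff p m X Z q :
  prim_fb p m X Z q.+1 - prim_fb p m (X + 1) Z q = kernel p m X Z q.+1.
Proof.
rewrite /prim_fb kernel_pos //.
have -> : X + 1 + q%:R = X + q.+1%:R by rewrite -natr1; ring.
rewrite opprD addrACA subrr add0r.
rewrite [RHS]big_ltn // [X in X - _]big_ltn // mul1r -addrA; congr (_ + _).
rewrite !big_add1 /= -sumrB; apply: eq_bigr => i _.
have -> : X + 1 + i%:R = X + i.+1%:R by rewrite -natr1; ring.
have -> : Z + i%:R - q%:R = Z + i.+1%:R - q.+1%:R by rewrite -!natr1; ring.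
by rewrite -!natr1; ring.
Qed.

Lemma prim_bf_diff p m X Z q :
  prim_bf p m X (Z + 1) q.+1 - prim_bf p m X Z q = kernel p m X Z q.+1.
Proof.
rewrite /prim_bf kernel_pos //.
have -> : Z + 1 - q.+1%:R - 1 = Z - q%:R - 1 by rewrite -natr1; ring.
rewrite opprD addrACA subrr add0r.
rewrite big_nat_recr //= [in RHS]big_nat_recr //= addrAC -sumrB; congr (_ + _).
  apply: eq_bigr => i _.
  have -> : Z + 1 + i%:R - q.+1%:R - 1 = Z + i%:R - q%:R - 1 by rewrite -natr1; ring.
  have -> : Z + i%:R - q.+1%:R = Z + i%:R - q%:R - 1 by rewrite -natr1; ring.
  by rewrite -natr1; ring.
have -> : Z + 1 + q%:R - q.+1%:R - 1 = Z + q%:R - q.+1%:R by ring.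
by rewrite -natr1; ring.
Qed.

(** Write both sides as sums over [i < q] plus boundary terms. The summand of their
    difference is [G (i + 1) - G i] where [G] is a polynomial times the product of two
    binomial coefficients. Here [al], [be], [ga], [de] are the totals of the four colours. *)
Lemma kernel_identity (x al be ga de : rat) (p m q : nat) :
  (0 < p)%N -> (0 < m)%N ->
  al + be = p%:R - q%:R -> ga + de = m.+1%:R + q%:R ->
  let X := x + al in let Z := x + ga in
    al * (X * kernel p m (X - 1) Z q.+1 + 2 * (- kernel p.+1 m X Z q.+1 - prim_bb p m X Z q +
      prim_fb p m X Z q))
  + be * ((x - be) * kernel p m X Z q.+1 + 2 * (- kernel p.+1 m X Z q.+1 - prim_bf p m X Z q +
    prim_ff p m X Z q))
  + ga * (Z * kernel p m X (Z - 1) q + 2 * (prim_bb p m X Z q - prim_bf p m X Z q - kernel p m.+1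
    X Z q))
  + de * ((x - de) * kernel p m X Z q + 2 * (prim_fb p m X Z q - prim_ff p m X Z q - kernel p
    m.+1 X Z q))
  = (m.+1 * m)%:R * kernel p m.+1 X Z q + (p * p.+1)%:R * kernel p.+1 m X Z q.+1.
Proof.
case: p => // p _; case: m => // m _ eal ega X Z.
have ex : x = X - al by rewrite /X addrK.
have {eal}ebe : be = p.+1%:R - q%:R - al by rewrite -eal addrC addKr.
have {ega}ede : de = m.+2%:R + q%:R - ga by rewrite -ega addrC addKr.
have ega : ga = Z - X + al by rewrite /X /Z; ring.
move: (X : rat) (Z : rat) ex ega => {}X {}Z -> ega.
have p0 := natS_neq0 p; have p1 := natS_neq0 p.+1.
have m0 := natS_neq0 m; have m1 := natS_neq0 m.+1; have m2 := natS_neq0 m.+2.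
rewrite -!natr1 in p0 p1 m0 m1 m2.
case: (posnP q) => [q0|q0].
  rewrite q0 /kernel !big_nat1 /prim_bb /prim_ff /prim_fb /prim_bf !big_geq // ?mulr0n ?oppr0
    ?addr0 ede ebe q0 ega.
  rewrite (gbinSl X p.+1) (gbinSl X p) (gbinSr (X-1) p).
  rewrite (gbinSl Z m.+2) (gbinSl Z m.+1) (gbinSr (Z-1) m.+1).
  rewrite !natrM -!natr1; field.
  by rewrite ?m2 ?p0 ?p1 ?m0 ?m1.
pose s1 (i : nat) := gbin (X - 1 + i%:R) p.+1 * gbin (Z + i%:R - q.+1%:R) m.+1.
pose s2 (i : nat) := gbin (X + i%:R) p.+1 * gbin (Z + i%:R - q.+1%:R) m.+1.
pose s4 (i : nat) := gbin (X + i%:R) p.+1 * gbin (Z + i%:R - q%:R) m.+1.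
pose sA (i : nat) := gbin (X + i%:R) p.+2 * gbin (Z + i%:R - q.+1%:R) m.+1.
pose sB (i : nat) := gbin (X + i%:R) p.+1 * gbin (Z + i%:R - q%:R) m.+2.
pose P (i : nat) := al * X * s1 i + (be * (X - al - be) + ga * Z) * s2 i
   + de * (X - al - de) * s4 i - (2 * (be + ga) + (p.+1 * p.+2)%:R) * sA i
   - (2 * (be + ga) + (m.+2 * m.+1)%:R) * sB i + 2 * (al + de) * (i.+1%:R * s4 i)
   - 2 * (be + ga) * ((q%:R - i%:R) * s2 i).
(* The polynomial factor of degree 2 in j is the solution of the telescoping equation PG
   for the given products of binomial coefficients. *)
pose G (j : nat) := (j%:R * (j%:R + X + al) - 2 * (be + ga) / (m.+2%:R * p.+2%:R)
       * (j%:R + X) * (j%:R - q%:R - m.+2%:R + Z))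
     * (gbin (X + j%:R - 1) p.+1 * gbin (Z + j%:R - q%:R - 1) m.+1).
have PG (i : nat) : P i = G i.+1 - G i.
  rewrite /P /G /s1 /s2 /s4 /sA /sB.
  have -> : X - 1 + i%:R = X + i%:R - 1 by ring.
  have -> : X + i.+1%:R - 1 = X + i%:R by rewrite -natr1; ring.
  have -> : Z + i%:R - q.+1%:R = Z + i%:R - q%:R - 1 by rewrite -natr1; ring.
  have -> : Z + i.+1%:R - q%:R - 1 = Z + i%:R - q%:R by rewrite -natr1; ring.
  set a := X + i%:R; set b := Z + i%:R - q%:R.
  have -> : X = a - i%:R by rewrite /a addrK.
  have eZ : Z = b - i%:R + q%:R by rewrite /b; ring.
  rewrite ebe ede ega.
  have -> : X = a - i%:R by rewrite /a addrK.
  rewrite eZ; move: (a : rat) (b : rat) => {eZ}a {}b.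
  rewrite (gbinSl a p.+1) (gbinSl a p) (gbinSr (a - 1) p).
  rewrite (gbinSl b m.+1) (gbinSr (b - 1) m) (gbinSl b m).
  rewrite !natrM -!natr1; field.
  by rewrite ?m0 ?p0 ?p1 ?m0 ?m1.
have tel : \sum_(0 <= i < q) P i = G q - G 0.
  by rewrite -telescope_sumr //; apply: eq_bigr => i _.
pose S (f : nat -> rat) := \sum_(0 <= i < q) f i.
have eP : \sum_(0 <= i < q) P i = al * X * S s1 + (be * (X - al - be) + ga * Z) * S s2
   + de * (X - al - de) * S s4 - (2 * (be + ga) + (p.+1 * p.+2)%:R) * S sA
   - (2 * (be + ga) + (m.+2 * m.+1)%:R) * S sB
   + 2 * (al + de) * S (fun i => i.+1%:R * s4 i)
   - 2 * (be + ga) * S (fun i => (q%:R - i%:R) * s2 i).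
  by rewrite /P !(big_split, sumrN) /= -!mulr_sumr.
rewrite eP in tel.
have E1 : kernel p.+1 m.+1 (X - 1) Z q.+1 = S s1 + s1 q by rewrite kernel_pos // big_nat_recr.
have E2 : kernel p.+1 m.+1 X Z q.+1 = S s2 + s2 q by rewrite kernel_pos // big_nat_recr.
have E3 : kernel p.+1 m.+1 X (Z - 1) q = S s2.
  rewrite kernel_pos //; apply: eq_bigr => i _; rewrite /s2.
  by have -> : Z - 1 + i%:R - q%:R = Z + i%:R - q.+1%:R by rewrite -natr1; ring.
have E4 : kernel p.+1 m.+1 X Z q = S s4 by rewrite kernel_pos.
have EA : kernel p.+2 m.+1 X Z q.+1 = S sA + sA q by rewrite kernel_pos // big_nat_recr.
have EB : kernel p.+1 m.+2 X Z q = S sB by rewrite kernel_pos.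
have Egbb : prim_bb p.+1 m.+1 X Z q = gbin (X + q%:R) p.+2 * gbin (Z - 1) m.+2 - S sA.
  rewrite /prim_bb; congr (_ - _); apply: eq_bigr => i _; rewrite /sA.
  by have -> : Z + i%:R - q%:R - 1 = Z + i%:R - q.+1%:R by rewrite -natr1; ring.
have Egbf : prim_bf p.+1 m.+1 X Z q = gbin X p.+2 * gbin (Z - q%:R - 1) m.+2
     + S (fun i => (q%:R - i%:R) * s2 i).
  rewrite /prim_bf; congr (_ + _); apply: eq_bigr => i _; rewrite /s2.
  by have -> : Z + i%:R - q%:R - 1 = Z + i%:R - q.+1%:R by rewrite -natr1; ring.
rewrite E1 E2 E3 E4 EA EB Egbb Egbf /prim_ff /prim_fb.
rewrite -/(S sB) -/(S (fun i => i.+1%:R * s4 i)).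
have tel' := tel; move: tel'.
set T6 := S (fun i => (q%:R - i%:R) * _); set T5 := S (fun i => _ * s4 i).
set T1 := S s1; set T2 := S s2; set T4 := S s4; set TA := S sA; set TB := S sB.
rewrite /G mul0r !add0r /s1 /s2 /sA.
move: T1 T2 T4 T5 T6 TA TB => T1 T2 T4 T5 T6 TA TB.
have -> : Z + q%:R - q%:R - 1 = Z - 1 by ring.
have -> : Z + q%:R - q.+1%:R = Z - 1 by rewrite -natr1; ring.
have -> : X - 1 + q%:R = X + q%:R - 1 by ring.
rewrite !addr0.
move/eqP; rewrite -subr_eq0 => /eqP H.
apply/eqP; rewrite -subr_eq0; apply/eqP; rewrite -[RHS]H.
rewrite (gbinSl (X + q%:R) p.+1) (gbinSl (X + q%:R) p) (gbinSr (X + q%:R - 1) p).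
rewrite (gbinSl X p.+1) (gbinSl Z m.+1) (gbinSr (Z - 1) m.+1) (gbinSr (Z - q%:R - 1) m.+1).
rewrite ebe ede ega !natrM -!natr1; field.
by rewrite ?m0 ?p0 ?p1 ?m0 ?m1.
Qed.

(** The case in which the small colours have used up [p + 1], so that dropping a small unit
    is the only way to reach a nonzero kernel. *)
Lemma kernel_identity0 (x al be ga de : rat) (p m : nat) :
  al + be = p.+1%:R -> ga + de = m%:R ->
  let X := x + al in let Z := x + ga in
    al * (X * kernel p m (X - 1) Z 0 - 2 * kernel p.+1 m X Z 0)
  + be * ((x - be) * kernel p m X Z 0 - 2 * kernel p.+1 m X Z 0)
  = (p * p.+1)%:R * kernel p.+1 m X Z 0.
Proof.
move=> eal ega X Z.
have ex : x = X - al by rewrite /X addrK.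
have {eal}ebe : be = p.+1%:R - al by rewrite -eal addrC addKr.
rewrite ex ebe /kernel; move: (X : rat) (Z : rat) => {ex}X {}Z.
have p0 := natS_neq0 p; have p1 := natS_neq0 p.+1; rewrite -!natr1 in p0 p1.
rewrite (gbinSl X p.+1) (gbinSl X p) (gbinSr (X - 1) p).
rewrite natrM -!natr1; field.
by rewrite ?p0 ?p1.
Qed.

(** * Two cycles: the coefficient function on four colours *)

Notation colours4 := (bool * bool)%type.

Section TwoCycleKernel.
Variable x : rat.

Definition small_size (n : {ffun colours4 -> nat}) := (n (false, true) + n (false, false))%N.

Definition kernel_coef (K : rat -> rat -> nat -> rat) p (n : {ffun colours4 -> nat}) : rat :=
  if (small_size n <= p)%N then
    K (x + (n (false, true))%:R) (x + (n (true, true))%:R) (p - small_size n)%N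
  else 0.

Definition two_cycle_coef p m := kernel_coef (kernel p m) p.

(** The primitives of [two_cycle_coef] required by [insertion_sum_colour_sum]. Between two
    colours of the same kind the primitive is again a coefficient function, for a cycle
    longer by one. *)
Definition two_cycle_prim p m (i j : colours4) (n : {ffun colours4 -> nat}) : rat :=
  match i, j with
  | (false, true), (false, false) => two_cycle_coef p.+1 m n
  | (false, false), (false, true) => - two_cycle_coef p.+1 m n
  | (true, true), (true, false) => two_cycle_coef p m.+1 n
  | (true, false), (true, true) => - two_cycle_coef p m.+1 n
  | (true, true), (false, true) => kernel_coef (prim_bb p m) p n
  | (false, true), (true, true) => - kernel_coef (prim_bb p m) p n
  | (true, false), (false, false) => kernel_coef (prim_ff p m) p n
  | (false, false), (true, false) => - kernel_coef (prim_ff p m) p n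
  | (true, false), (false, true) => kernel_coef (prim_fb p m) p n
  | (false, true), (true, false) => - kernel_coef (prim_fb p m) p n
  | (true, true), (false, false) => kernel_coef (prim_bf p m) p n
  | (false, false), (true, true) => - kernel_coef (prim_bf p m) p n
  | _, _ => 0
  end.

Lemma sum_colours4 (F : colours4 -> rat) :
  \sum_j F j = F (false, true) + F (false, false) + F (true, true) + F (true, false).
Proof.
rewrite (eq_bigr (fun j => F (j.1, j.2))) => [|[] //].
by rewrite -(pair_bigA _ (fun a b => F (a, b))) /= !big_bool /= addrC !addrA.
Qed.

Lemma sum_colours4n (F : colours4 -> nat) :
  (\sum_j F j = F (false, true) + F (false, false) + F (true, true) + F (true, false))%N.
Proof.
rewrite (eq_bigr (fun j => F (j.1, j.2))) => [|[] //].
by rewrite -(pair_bigA _ (fun a b => F (a, b))) /= !big_bool /= addnC !addnA.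
Qed.

Lemma two_cycle_prim_anti p m i j n : i != j -> two_cycle_prim p m i j n = - two_cycle_prim p m j
  i n.
Proof. by case: i j => [[] []] [[] []] //= _; rewrite ?opprK. Qed.

Lemma kernel_coef_hi K p n : (p < small_size n)%N -> kernel_coef K p n = 0.
Proof. by rewrite /kernel_coef ltnNge => /negPf->. Qed.

Lemma kernel_coef_le K p q n : (small_size n + q = p)%N ->
  kernel_coef K p n = K (x + (n (false, true))%:R) (x + (n (true, true))%:R) q.
Proof. by rewrite /kernel_coef => <-; rewrite leq_addr addKn. Qed.

Lemma small_size_add n i k : small_size (add_size n i k) = (small_size n + (~~ i.1) * k)%N.
Proof.
by case: i => [[] []]; rewrite /small_size !ffunE /= ; lia.
Qed.

Lemma add_size_ft n i k : (add_size n i k (false, true) = n (false, true) + (i == (false, true))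
  * k)%N.
Proof. by rewrite ffunE eq_sym. Qed.

Lemma add_size_tt n i k : (add_size n i k (true, true) = n (true, true) + (i == (true, true)) *
  k)%N.
Proof. by rewrite ffunE eq_sym. Qed.

Lemma kernel_coef_add K p q n (i : colours4) : (small_size n + ~~ i.1 + q = p)%N ->
  kernel_coef K p (add_size n i 1) = K (x + (n (false, true))%:R + (~~ i.1 && i.2)%:R)
     (x + (n (true, true))%:R + (i.1 && i.2)%:R) q.
Proof.
move=> eq; rewrite (@kernel_coef_le _ _ q) ?small_size_add ?muln1 ?add_size_ft ?add_size_tt.
  by rewrite !muln1 !natrD !addrA; case: i eq => [[] []].
by move: eq; case: i.1 => /=; lia.
Qed.

(** At the boundary, where the small colours have used up [p], the primitive survives only
    on the big side, and the [q = 0] value of [kernel] is exactly that term. *)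
Lemma two_cycle_prim_diff p m i j n : i != j ->
  two_cycle_prim p m i j (add_size n i 1) - two_cycle_prim p m i j (add_size n j 1) =
    two_cycle_coef p m n.
Proof.
have [hi|lo] := ltnP p (small_size n).
  rewrite /two_cycle_coef kernel_coef_hi // => nij.
  by case: i j nij => [[] []] [[] []] //= _;
    rewrite /two_cycle_coef !kernel_coef_hi ?subr0 ?oppr0 ?subrr // small_size_add /=; lia.
have [q eq] : exists q, (small_size n + q = p)%N by exists (p - small_size n)%N; rewrite subnKC.
rewrite [two_cycle_coef p m n](kernel_coef_le _ eq).
(* By antisymmetry it suffices to treat the six pairs with big before small and plus
   before minus. *)
wlog : i j / (j.1 ==> i.1) && ((j.1 == i.1) ==> i.2) => [wl nij|].
  have [h|h] := boolP ((j.1 ==> i.1) && ((j.1 == i.1) ==> i.2)); first exact: wl.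
  rewrite (two_cycle_prim_anti _ _ _ nij) [two_cycle_prim _ _ i j _](two_cycle_prim_anti _ _ _
    nij) opprK addrC.
  by apply: wl; [move: h nij; case: i j => [[] []] [[] []] | rewrite eq_sym].
case: i j => [[] []] [[] []] //= _ _.
- by rewrite /two_cycle_coef !(@kernel_coef_add _ _ q) /= ?addn0 // ?mulr0n ?addr0 kernel_diffZ.
- case: q eq => [|q] eq.
    rewrite (@kernel_coef_add _ _ 0 _ (true, true)) /=; last by lia.
    rewrite kernel_coef_hi ?small_size_add /=; last by lia.
    by rewrite /prim_bb big_geq // ?mulr0n ?mulr1n ?subr0 ?addrK ?addr0.
  rewrite (@kernel_coef_add _ _ q.+1 _ (true, true)) /=; last by lia.
  rewrite (@kernel_coef_add _ _ q _ (false, true)) /=; last by lia.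
  by rewrite ?mulr0n ?addr0 prim_bb_diff.
- case: q eq => [|q] eq.
    rewrite (@kernel_coef_add _ _ 0 _ (true, true)) /=; last by lia.
    rewrite kernel_coef_hi ?small_size_add /=; last by lia.
    by rewrite /prim_bf big_geq // ?mulr0n ?mulr1n ?subr0 ?addrK ?addr0.
  rewrite (@kernel_coef_add _ _ q.+1 _ (true, true)) /=; last by lia.
  rewrite (@kernel_coef_add _ _ q _ (false, false)) /=; last by lia.
  by rewrite ?mulr0n ?addr0 prim_bf_diff.
- case: q eq => [|q] eq.
    rewrite (@kernel_coef_add _ _ 0 _ (true, false)) /=; last by lia.
    rewrite kernel_coef_hi ?small_size_add /=; last by lia.
    by rewrite /prim_fb big_geq // ?mulr0n ?mulr1n ?subr0 ?addrK ?addr0.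
  rewrite (@kernel_coef_add _ _ q.+1 _ (true, false)) /=; last by lia.
  rewrite (@kernel_coef_add _ _ q _ (false, true)) /=; last by lia.
  by rewrite ?mulr0n ?addr0 prim_fb_diff.
- case: q eq => [|q] eq.
    rewrite (@kernel_coef_add _ _ 0 _ (true, false)) /=; last by lia.
    rewrite kernel_coef_hi ?small_size_add /=; last by lia.
    by rewrite /prim_ff big_geq // ?mulr0n ?mulr1n ?subr0 ?addrK ?addr0.
  rewrite (@kernel_coef_add _ _ q.+1 _ (true, false)) /=; last by lia.
  rewrite (@kernel_coef_add _ _ q _ (false, false)) /=; last by lia.
  by rewrite ?mulr0n ?addr0 prim_ff_diff.
- by rewrite /two_cycle_coef !(@kernel_coef_add _ _ q) /= ?addn1 ?addSn ?eq // ?mulr0n ?addr0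
    kernel_diffX.
Qed.

Lemma small_size_drop (n : {ffun colours4 -> nat}) i : (0 < n i)%N -> small_size (drop_size n i)
  = (small_size n - ~~ i.1)%N.
Proof. by case: i => [[] []]; rewrite /small_size !ffunE /=; lia. Qed.

Lemma kernel_coef_drop K p q (n : {ffun colours4 -> nat}) (i : colours4) : (0 < n i)%N ->
  (small_size n + q = p + ~~ i.1)%N ->
  kernel_coef K p (drop_size n i) = K (x + (n (false, true))%:R - ((false, true) == i)%:R)
     (x + (n (true, true))%:R - ((true, true) == i)%:R) q.
Proof.
move=> ni eq; rewrite (@kernel_coef_le _ _ q) ?small_size_drop //; last first.
  by move: ni eq; case: i => [[] []] /=; rewrite /small_size; lia.
rewrite !ffunE; congr (K _ _ q); case: eqP => [e|_] /=; rewrite ?subn0 ?subr0 //;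
  by rewrite -addrA e natrB.
Qed.

Lemma sum_colours4_neq (F : colours4 -> rat) j : \sum_(i | i != j) F i =
  ((false, true) != j)%:R * F (false, true) + ((false, false) != j)%:R * F (false, false)
  + ((true, true) != j)%:R * F (true, true) + ((true, false) != j)%:R * F (true, false).
Proof.
rewrite big_mkcond sum_colours4.
by do 4 (case: (_ != j)); rewrite ?mul1r ?mul0r.
Qed.

(** Three regimes for the total of the small colours: at most [p], where [kernel_identity]
    applies; [p + 1], where [kernel_identity0] applies; and more, where everything
    vanishes. *)
Lemma two_cycle_step p m mu : (0 < p)%N -> (0 < m)%N ->
  all (leq 1) mu -> sumn mu = (p + m).+1 ->
  insertion_sum x (colour_sum sign4 (two_cycle_coef p m)) mu = (m.+1 * m)%:R * colour_sum sign4
    (two_cycle_coef p m.+1) mu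
    + (p * p.+1)%:R * colour_sum sign4 (two_cycle_coef p.+1 m) mu.
Proof.
move=> p0 m0 mu0 smu.
rewrite (insertion_sum_colour_sum (g := two_cycle_prim p m) x sign4_sq sign4_sum) //; first last.
- by move=> i j n; exact: two_cycle_prim_diff.
- by move=> i j n; exact: two_cycle_prim_anti.
rewrite -!colour_sumZ -colour_sumD; apply: eq_colour_sum_total => n.
rewrite sum_colours4n smu /derived_coef sum_colours4 => tot.
rewrite !sum_colours4_neq /= !(mul0r, mul1r, add0r, addr0) /sign4 /= !(mulN1r, mul1r, opprK).
have mz (i : colours4) (u v w d : rat) : ((0 < n i)%N -> u = v) ->
    (n i)%:R * (w * u + d) = (n i)%:R * (w * v + d).
  by case: (n i) => [_|k ->] //; rewrite !mul0r.
have eal : (n (false, true))%:R + (n (false, false))%:R = (small_size n)%:R :> rat.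
  by rewrite -natrD.
have ega : (n (true, true))%:R + (n (true, false))%:R = (p + m).+1%:R - (small_size n)%:R :> rat.
  by rewrite -tot /small_size !natrD; ring.
have [hi|lo] := ltnP p (small_size n); last first.
  have [q eq] : exists q, (small_size n + q = p)%N by exists (p - small_size n)%N; rewrite subnKC.
  have dec (i : colours4) : (0 < n i)%N -> two_cycle_coef p m (drop_size n i) =
      kernel p m (x + (n (false, true))%:R - ((false, true) == i)%:R)
        (x + (n (true, true))%:R - ((true, true) == i)%:R) (if i.1 then q else q.+1).
    move=> h; apply: kernel_coef_drop => //.
    by case: (i) => [[] []] /=; lia.
  rewrite (mz _ _ _ _ _ (dec (false, true))) (mz _ _ _ _ _ (dec (false, false))).
  rewrite (mz _ _ _ _ _ (dec (true, true))) (mz _ _ _ _ _ (dec (true, false))).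
  rewrite /= ?mulr0n ?mulr1n ?subr0.
  rewrite /two_cycle_coef (@kernel_coef_le _ _ q.+1) ?addnS ?eq // !(kernel_coef_le _ eq).
  apply: kernel_identity => //; first by rewrite eal -eq natrD addrK.
  rewrite ega (_ : (p + m).+1 = (small_size n + (m.+1 + q))%N); last by lia.
  by rewrite natrD addrAC subrr add0r natrD.
have [hi'|lo] := ltnP p.+1 (small_size n).
  have dec (i : colours4) : (0 < n i)%N -> two_cycle_coef p m (drop_size n i) = 0.
    by move=> h; rewrite /two_cycle_coef kernel_coef_hi // small_size_drop //;
      case: (i) => [[] []] /=; lia.
  rewrite (mz _ _ _ _ _ (dec (false, true))) (mz _ _ _ _ _ (dec (false, false))).
  rewrite (mz _ _ _ _ _ (dec (true, true))) (mz _ _ _ _ _ (dec (true, false))).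
  by rewrite /two_cycle_coef !kernel_coef_hi //; ring.
have eq : small_size n = p.+1 by lia.
have dec (i : colours4) : (0 < n i)%N -> two_cycle_coef p m (drop_size n i) =
    if i.1 then 0 else kernel p m (x + (n (false, true))%:R - ((false, true) == i)%:R)
        (x + (n (true, true))%:R) 0.
  case: (boolP i.1) => [bi|/negPf bi] h.
    by rewrite /two_cycle_coef kernel_coef_hi // small_size_drop // bi /= subn0 eq.
  rewrite /two_cycle_coef (@kernel_coef_drop _ _ 0) //; last by rewrite bi eq addn0 addn1.
  by case: i bi {h} => [[] []] //= _; rewrite ?mulr0n !subr0.
rewrite (mz _ _ _ _ _ (dec (false, true))) (mz _ _ _ _ _ (dec (false, false))).
rewrite (mz _ _ _ _ _ (dec (true, true))) (mz _ _ _ _ _ (dec (true, false))).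
rewrite /= ?mulr0n ?mulr1n ?subr0 /two_cycle_coef !(kernel_coef_hi _ hi).
rewrite (@kernel_coef_le _ _ 0) ?eq ?addn0 //.
have := @kernel_identity0 x (n (false, true))%:R (n (false, false))%:R
  (n (true, true))%:R (n (true, false))%:R p m.
rewrite eal ega eq -addSn natrD addrAC subrr add0r => /(_ erefl erefl) /= <-.
by ring.
Qed.

End TwoCycleKernel.

(** * Deleting a point from a permutation *)

Section Perms.
Variable T : finType.
Implicit Types (a g : {perm T}) (N P Q : {set T}) (z o b : T).

(** Composing with [(a o, o)] short-cuts [o]: its preimage is sent to its image and [o]
    becomes a fixed point. *)
Definition excise a o : {perm T} := (a * tperm (a o) o)%g.

Lemma exciseE a o z : z != o -> excise a o z = if a z == o then a o else a z.
Proof.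
move=> zo; rewrite permM.
have az : a z != a o by rewrite (inj_eq perm_inj).
case: eqP => [->|/eqP h]; first by rewrite tpermR.
by rewrite tpermD // eq_sym.
Qed.

Lemma excise_o a o : excise a o o = o.
Proof. by rewrite permM tpermL. Qed.

Lemma excise_fix a o : a o = o -> excise a o = a.
Proof. by rewrite /excise => ->; rewrite tperm1 mulg1. Qed.

Lemma porbit_excise a o z : a o != o -> z != o ->
  porbit (excise a o) z = porbit a z :\ o.
Proof.
move=> ao zo; apply/setP=> y; rewrite in_setD1; apply/idP/andP.
  case/porbitP=> i ->; elim: i => [|i [IH1 IH2]].
    by rewrite expg0 perm1 zo porbit_id.
  rewrite expgSr permM exciseE //.
  have st u : u \in porbit a z -> a u \in porbit a z.
    by case/porbitP=> k ->; apply/porbitP; exists k.+1; rewrite expgSr permM.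
  have [e|e] := eqVneq (a ((excise a o ^+ i)%g z)) o; split=> //; last exact: st.
  by have := st _ (st _ IH2); rewrite e.
case=> yo /porbitP[i ei]; rewrite {}ei in yo *.
have step u : u != o -> u \in porbit (excise a o) z -> excise a o u \in porbit (excise a o) z.
  by move=> _ /porbitP[k ->]; apply/porbitP; exists k.+1; rewrite expgSr [RHS]permM.
elim/ltn_ind: i yo => -[|i] IH; first by rewrite expg0 perm1 porbit_id.
rewrite expgSr permM.
have [e|ne] := eqVneq ((a ^+ i)%g z) o.
  case: i e IH => [|i]; first by rewrite expg0 perm1 => e; rewrite e eqxx in zo.
  rewrite expgSr permM => e IH _.
  have ne : (a ^+ i)%g z != o by apply: contraNneq ao => e'; rewrite -[X in _ == X]e e'.
  have := step _ ne (IH i (ltnW (ltnSn _)) ne).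
  by rewrite exciseE // e eqxx.
move=> yo; have := step _ ne (IH i (ltnSn _) ne).
by rewrite exciseE // (negPf yo).
Qed.

Lemma porbit_fixed a z : a z = z -> porbit a z = [set z].
Proof.
move=> az; apply/setP=> y; rewrite inE; apply/porbitP/eqP => [[i ->]|->].
  by elim: i => [|i IH]; rewrite ?expg0 ?perm1 // expgSr permM IH.
by exists 0%N; rewrite expg0 perm1.
Qed.

Lemma card_porbits1 : #|porbits (1 : {perm T})%g| = #|T|.
Proof.
have -> : porbits (1 : {perm T})%g = [set [set z] | z in T].
  apply/setP=> X; apply/imsetP/imsetP => -[z _ ->]; exists z => //;
    by rewrite porbit_fixed ?perm1.
by rewrite card_imset //; exact: set1_inj.
Qed.

(** The cycle of [o] splits into [o] alone and the rest. *)
Lemma card_porbits_excise a o : a o != o ->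
  #|porbits (excise a o)| = #|porbits a|.+1.
Proof.
move=> ao.
have -> : excise a o = (tperm o ((a^-1)%g o) * a)%g.
  apply/permP=> z; rewrite !permM.
  case: (tpermP o ((a^-1)%g o) z) => [->|->|/eqP h1 /eqP h2];
    rewrite ?permKV ?tpermR ?tpermL //.
  have h3 : a z != o by apply: contraNneq h2 => e; rewrite -e permK.
  by rewrite tpermD // eq_sym // (inj_eq perm_inj).
have := porbits_mul_tperm a o ((a^-1)%g o); rewrite /=.
have -> : o \in porbit a ((a^-1)%g o).
  by apply/porbitP; exists 1%N; rewrite expg1 permKV.
have -> : (o != (a^-1)%g o) = true.
  by apply: contra ao => /eqP e; rewrite {1}e permKV.
by rewrite addn0 addn1.
Qed.

(** The permutations that are a single cycle on [P], a single cycle on [Q], and the identity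
    elsewhere. Either set may be empty, which covers single cycles. *)
Definition two_cycles P Q : pred {perm T} := fun g =>
  [&& perm_on (P :|: Q) g, [forall z in P, porbit g z == P]
    & [forall z in Q, porbit g z == Q]].

Lemma two_cyclesP P Q g : reflect
  [/\ forall z, z \notin P -> z \notin Q -> g z = z,
      forall z, z \in P -> porbit g z = P &
      forall z, z \in Q -> porbit g z = Q] (two_cycles P Q g).
Proof.
apply: (iffP and3P) => [[h1 /forall_inP h2 /forall_inP h3]|[h1 h2 h3]]; split.
- by move=> z zP zQ; apply: (out_perm h1); rewrite in_setU negb_or zP.
- by move=> z /h2/eqP.
- by move=> z /h3/eqP.
- apply/subsetP=> z; rewrite inE in_setU; apply: contraR; rewrite negb_or.
  by case/andP=> zP zQ; rewrite h1.
- by apply/forall_inP=> z /h2->.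
- by apply/forall_inP=> z /h3->.
Qed.

Lemma two_cyclesC P Q g : two_cycles P Q g = two_cycles Q P g.
Proof. by apply/two_cyclesP/two_cyclesP => -[h1 h2 h3]; split=> // z u v; exact: h1. Qed.

(** A cycle through [o] and [Q] is the same as a cycle on [Q] together with the image of
    [o]. *)
Lemma two_cycles_excise P Q o g : o \notin P -> o \notin Q -> [disjoint P & Q] -> Q != set0 ->
  two_cycles P (o |: Q) g = (g o \in Q) && two_cycles P Q (excise g o).
Proof.
move=> oP oQ dPQ Q0; apply/two_cyclesP/andP => [[h1 h2 h3]|[goQ /two_cyclesP[h1 h2 h3]]].
  have poro : porbit g o = o |: Q by apply: h3; rewrite setU11.
  have go : g o != o.
    apply: contra Q0 => /eqP /porbit_fixed; rewrite poro => e.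
    apply/eqP/setP=> z; rewrite inE; apply: negbTE; apply: contra oQ => zQ.
    have : z \in [set o] by rewrite -e in_setU1 zQ orbT.
    by rewrite inE => /eqP <-.
  have goQ : g o \in Q.
    have : g o \in porbit g o by apply/porbitP; exists 1%N; rewrite expg1.
    by rewrite poro in_setU1 (negPf go).
  split=> //; apply/two_cyclesP; split=> z.
  - have [-> _ _|zo zP zQ] := eqVneq z o; first exact: excise_o.
    have gz : g z = z by apply: h1; rewrite // in_setU1 negb_or zo.
    by rewrite exciseE // gz (negPf zo).
  - move=> zP; have zo : z != o by apply: contraNneq oP => <-.
    rewrite porbit_excise // h2 //; apply/setDidPl.
    by rewrite disjoint_sym disjoints1.
  - move=> zQ; have zo : z != o by apply: contraNneq oQ => <-.
    by rewrite porbit_excise // h3 ?setU1K // in_setU1 zQ orbT.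
have go : g o != o by apply: contraNneq oQ => <-.
have oin z : (o \in porbit g z) = (g o \in porbit g z).
  by apply/idP/idP; rewrite ![_ \in porbit g z]porbit_sym -!eq_porbit_mem -(porbit_perm g 1 o)
    expg1.
have hQ z : z \in Q -> porbit g z = o |: Q.
  move=> zQ; have zo : z != o by apply: contraNneq oQ => <-.
  have := h3 z zQ; rewrite porbit_excise // => e.
  rewrite -e setD1K // oin; move: goQ; rewrite -{1}e in_setD1; by case/andP.
split=> z.
- move=> zP; rewrite in_setU1 negb_or => /andP[zo zQ].
  have := h1 z zP zQ; rewrite exciseE //; case: eqP => // _ e.
  by rewrite -e goQ in zQ.
- move=> zP; have zo : z != o by apply: contraNneq oP => <-.
  have := h2 z zP; rewrite porbit_excise // => e.
  rewrite -[RHS]e; apply/esym/setDidPl; rewrite disjoint_sym disjoints1 oin.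
  apply/negP => h; have : g o \in P by rewrite -e in_setD1 go.
  by move/(disjointFr dPQ); rewrite goQ.
- rewrite in_setU1 => /orP[/eqP->|/hQ //].
  by rewrite -(hQ _ goQ) -{1}(porbit_perm g 1) expg1.
Qed.

Lemma sum_two_cycles_insert (f : {perm T} -> rat) P Q o :
  o \notin P -> o \notin Q -> [disjoint P & Q] -> Q != set0 ->
  \sum_(g | two_cycles P (o |: Q) g) f g =
  \sum_(g | two_cycles P Q g) \sum_(b in Q) f (g * tperm b o)%g.
Proof.
move=> oP oQ dPQ Q0; rewrite pair_big /=.
rewrite (reindex_onto (fun q : {perm T} * T => q.1 * tperm q.2 o)%g
   (fun g => (excise g o, g o))) /=; last first.
  by move=> g _; rewrite /excise -mulgA tperm2 mulg1.
apply: eq_bigl => -[g b] /=; rewrite two_cycles_excise //.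
apply/andP/andP => [[/andP[h1 h2] /eqP[eg eo]]|[h1 h2]].
  by rewrite eg eo in h1 h2.
have go : g o = o by case/two_cyclesP: h1 => h1 _ _; apply: h1.
have e : (g * tperm b o)%g o = b by rewrite permM go tpermR.
have e2 : excise (g * tperm b o)%g o = g by rewrite /excise e -mulgA tperm2 mulg1.
by rewrite e e2 h1 h2.
Qed.

End Perms.

(** * Summing over the permutations with two prescribed cycles *)

Section Weights.
Variable T : finType.
Implicit Types (a g : {perm T}) (N P Q M : {set T}) (z o b : T).
Variable x : rat.
Hypothesis x0 : x != 0.

(** The number of cycles restricted to [N], as an exponent of [x]: the fixed points outside
    [N] are divided out. Permutations of every subset thus live on the same type. *)
Definition weight N g : rat := x ^+ #|porbits g| / x ^+ #|~: N|.

Lemma card_setCD1 N o : o \in N -> #|~: (N :\ o)| = #|~: N|.+1.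
Proof. by move=> oN; rewrite setCD setUC cardsU1 inE oN. Qed.

Lemma weight_fix N g o : o \in N -> weight N g = x * weight (N :\ o) g.
Proof.
move=> oN; rewrite /weight card_setCD1 // exprS.
by rewrite invfM [X in x * X]mulrCA mulVKf.
Qed.

Lemma weight_excise N g o : o \in N -> g o != o -> weight N g = weight (N :\ o) (excise g o).
Proof.
move=> oN go; rewrite /weight card_setCD1 // card_porbits_excise // !exprS invfM mulrACA.
by rewrite divff // mul1r.
Qed.

(** The sum of [x ^ kappa(a g)] over all [g] with two cycles of lengths [p] and [#|N| - p]
    on [N], the first of which is marked; for [p = 0] it is the sum over the full cycles of
    [N]. *)
Definition two_cycle_gf p N a : rat :=
  \sum_(P : {set T} | (P \subset N) && (#|P| == p))
    \sum_(g | two_cycles P (N :\: P) g) weight N (a * g)%g.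

Definition fix_weight a o : rat := if a o == o then x else 1.

Lemma weight_fix_weight N a o : o \in N -> weight N a = fix_weight a o * weight (N :\ o) (excise
  a o).
Proof.
move=> oN; rewrite /fix_weight; case: eqP => [e|/eqP e]; last by rewrite mul1r (weight_excise oN e).
by rewrite excise_fix // (weight_fix _ oN).
Qed.

Lemma fix_weight_mul a g o : g o = o -> fix_weight (a * g)%g o = fix_weight a o.
Proof.
move=> go; rewrite /fix_weight permM; congr (if _ then _ else _).
by rewrite -{2}go (inj_eq perm_inj).
Qed.

(** A transposition on the right of [g] is moved to the left, so that it acts on [a] in [a *
    g]. *)
Lemma mul_tperm g b o : g o = o -> (g * tperm (g b) o = tperm b o * g)%g.
Proof. by move=> go; rewrite -{1}go -tpermJ conjgE mulKVg. Qed.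

Lemma excise_mul a g o : g o = o -> excise (a * g)%g o = (excise a o * g)%g.
Proof.
move=> go; rewrite /excise -!mulgA; congr (_ * _)%g.
by rewrite permM mul_tperm.
Qed.

Lemma two_cycles_fix P Q g o : two_cycles P Q g -> o \notin P -> o \notin Q -> g o = o.
Proof. by case/two_cyclesP => h _ _; apply: h. Qed.

Lemma two_cycles_closed P Q g z : two_cycles P Q g -> (g z \in P :|: Q) = (z \in P :|: Q).
Proof. by case/and3P => h _ _; rewrite -(perm_closed z h). Qed.

(** Inserting [o] into either cycle of [g]: the choices of [b] in the first cycle and in the
    second one together run over all of [N] minus [o]. Moving [(b o)] across [g] makes the
    summand depend on [a (b o)] only, and [g] again runs over all pairs of cycles. *)
Lemma sum_two_cycles_step N a o p : o \in N -> (p < #|N :\ o|)%N ->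
  \sum_(P : {set T} | (P \subset N :\ o) && (#|P| == p))
     (\sum_(g | two_cycles P (N :\: P) g) weight N (a * g)%g
      + if p == 0%N then 0 else \sum_(g | two_cycles (o |: P) (N :\: (o |: P)) g) weight N (a *
        g)%g)
  = \sum_(b in N :\ o) fix_weight (a * tperm b o)%g o * two_cycle_gf p (N :\ o) (excise (a *
    tperm b o) o).
Proof.
move=> oN; set M := N :\ o => pM.
have oM : o \notin M by rewrite setD11.
under [RHS]eq_bigr do rewrite /two_cycle_gf mulr_sumr.
rewrite [RHS]exchange_big /=; apply: eq_bigr => P /andP[PM /eqP cP].
have oP : o \notin P by apply: contra oM; apply: (subsetP PM).
have oD : o \notin M :\: P by rewrite inE negb_and oM orbT.
have dPD : [disjoint P & M :\: P] by rewrite -setI_eq0 setIDA setDIl setDv set0I.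
have D0 : M :\: P != set0.
  by rewrite -card_gt0 cardsDS // subn_gt0 cP.
have -> : N :\: P = o |: (M :\: P).
  by rewrite -(setD1K oN) -/M setDUl; congr (_ :|: _); apply/setDidPl; rewrite disjoints1.
have -> : N :\: (o |: P) = M :\: P by rewrite /M setDDl.
rewrite sum_two_cycles_insert //.
have -> : (if p == 0%N then 0 else \sum_(g | two_cycles (o |: P) (M :\: P) g) weight N (a * g)%g) =
   \sum_(g | two_cycles P (M :\: P) g) \sum_(b in P) weight N (a * (g * tperm b o))%g.
  case: eqP => [p0|/eqP p0].
    rewrite big1 // => g _; rewrite big1 // => b.
    by move/eqP: cP; rewrite p0 cards_eq0 => /eqP ->; rewrite inE.
  rewrite (eq_bigl (two_cycles (M :\: P) (o |: P))) => [|g]; last exact: two_cyclesC.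
  rewrite sum_two_cycles_insert //; first by apply: eq_bigl => g; exact: two_cyclesC.
  - by rewrite disjoint_sym.
  - by rewrite -card_gt0 cP lt0n.
under [RHS]eq_bigr do rewrite mulr_sumr.
rewrite -big_split [RHS]exchange_big /=; apply: eq_bigr => g tg.
have go : g o = o by apply: (two_cycles_fix tg).
have PDM : P :|: M :\: P = M by rewrite -{1}(setIidPr PM) setID.
rewrite addrC.
have -> : \sum_(b in P) weight N (a * (g * tperm b o))%g + \sum_(b in M :\: P) weight N (a * (g *
  tperm b o))%g
  = \sum_(b in M) weight N (a * (g * tperm b o))%g.
  by rewrite [RHS](big_setID P) (setIidPr PM).
rewrite (reindex_inj (@perm_inj _ g)) /=; apply: eq_big => [b|b bM].
  by rewrite -[in LHS]PDM two_cycles_closed // PDM.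
have -> : (a * (g * tperm (g b) o) = a * tperm b o * g)%g.
  by rewrite mul_tperm // mulgA.
by rewrite (weight_fix_weight _ oN) fix_weight_mul // excise_mul.
Qed.

Lemma two_cycle_gf0_rec N a o : o \in N -> (0 < #|N :\ o|)%N ->
  two_cycle_gf 0 N a = \sum_(b in N :\ o) fix_weight (a * tperm b o)%g o * two_cycle_gf 0 (N :\
    o) (excise (a * tperm b o) o).
Proof.
move=> oN N0; rewrite -(sum_two_cycles_step a oN N0) /two_cycle_gf.
have E M : (fun P : {set T} => (P \subset M) && (#|P| == 0%N)) =1 pred1 set0.
  by move=> P /=; rewrite cards_eq0 andbC; case: eqP => //= ->; rewrite sub0set.
by rewrite !(eq_bigl _ _ (E _)) !big_pred1_eq addr0.
Qed.

(** Summing [sum_two_cycles_step] over [o]: a marked pair of cycles arises once for every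
    point [o] of the enlarged cycle, that is [m + 1] times if [o] was inserted
    outside [P] and [p + 1] times if it was inserted in [P]. *)
Lemma two_cycle_gf_rec N a p m : (0 < p)%N -> (0 < m)%N -> #|N| = (p + m).+1 ->
  m.+1%:R * two_cycle_gf p N a + p.+1%:R * two_cycle_gf p.+1 N a =
  \sum_(o in N) \sum_(b in N :\ o)
     fix_weight (a * tperm b o)%g o * two_cycle_gf p (N :\ o) (excise (a * tperm b o) o).
Proof.
move=> p0 m0 cN.
rewrite [RHS](eq_bigr (fun o => \sum_(P : {set T} | (P \subset N :\ o) && (#|P| == p))
     (\sum_(g | two_cycles P (N :\: P) g) weight N (a * g)%g
      + \sum_(g | two_cycles (o |: P) (N :\: (o |: P)) g) weight N (a * g)%g))); last first.
  move=> o oN; rewrite -sum_two_cycles_step //; last by move: (cardsD1 o N); rewrite oN; lia.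
  by apply: eq_bigr => P _; rewrite (negPf (lt0n_neq0 p0)).
under [RHS]eq_bigr do rewrite big_split.
rewrite big_split; congr (_ + _).
  rewrite (exchange_big_dep (fun P : {set T} => (P \subset N) && (#|P| == p))) /=; last first.
    move=> o P oN /andP[h ->]; rewrite andbT; apply: subset_trans h _; exact: subD1set.
  rewrite mulr_sumr; apply: eq_bigr => P /andP[PN /eqP cP].
  rewrite (eq_bigl (mem (N :\: P))).
    by rewrite sumr_const cardsDS // cN cP subSn ?leq_addr // addKn mulr_natl.
  move=> o; rewrite /= subsetD1 PN cP eqxx andbT /= inE.
  by rewrite andbC.
rewrite (eq_bigr (fun o => \sum_(P : {set T} | (P \subset N) && (#|P| == p.+1) && (o \in P))
     \sum_(g | two_cycles P (N :\: P) g) weight N (a * g)%g)); last first.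
  move=> o oN; rewrite [RHS](reindex_onto (fun P => o |: P) (fun P => P :\ o)) /=; last first.
    by move=> P /andP[_ oP]; rewrite setD1K.
  apply: eq_bigl => P; rewrite setU11 andbT subUset sub1set oN /= cardsU1 subsetD1.
  have [oP|oP] := boolP (o \in P).
    rewrite andbF /=; symmetry; apply/negbTE; rewrite negb_and; apply/orP; right.
    by apply: contraTneq oP => <-; rewrite setD11.
  by rewrite setU1K // eqxx !andbT add1n eqSS.
rewrite (exchange_big_dep (fun P : {set T} => (P \subset N) && (#|P| == p.+1))) /=; last first.
  by move=> o P oN /andP[].
rewrite mulr_sumr; apply: eq_bigr => P /andP[PN /eqP cP].
rewrite (eq_bigl (mem P)).
  by rewrite sumr_const cP mulr_natl.
move=> o; rewrite /= PN cP eqxx /= .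
by have [oP|] := boolP (o \in P); rewrite ?andbF // (subsetP PN).
Qed.

(** A marked cycle of length 1 is a fixed point of [g]. *)
Lemma two_cycle_gf1 N a : (1 < #|N|)%N ->
  two_cycle_gf 1 N a = \sum_(o in N) fix_weight a o * two_cycle_gf 0 (N :\ o) (excise a o).
Proof.
move=> N1; rewrite /two_cycle_gf.
transitivity (\sum_(o in N) \sum_(g | two_cycles [set o] (N :\ o) g) weight N (a * g)%g).
  rewrite -(big_imset (fun P : {set T} => \sum_(g | two_cycles P (N :\: P) g) weight N (a * g)%g)
     (h := fun o => [set o])) /=; last by move=> u v _ _; exact: set1_inj.
  apply: eq_bigl => P; apply/andP/imsetP => [[PN /cards1P[o Po]]|[o oN ->]].
    by exists o => //; rewrite -sub1set -Po.
  by rewrite sub1set cards1.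
apply: eq_bigr => o oN.
have E M : (fun P : {set T} => (P \subset M) && (#|P| == 0%N)) =1 pred1 set0.
  by move=> P /=; rewrite cards_eq0 andbC; case: eqP => //= ->; rewrite sub0set.
rewrite (eq_bigl _ _ (E _)) big_pred1_eq setD0 mulr_sumr.
apply: eq_big => [g|g tg].
  apply/two_cyclesP/two_cyclesP => -[h1 h2 h3]; split => z.
  - move=> _ zN; have [->|zo] := eqVneq z o; last by apply: h1; rewrite // inE.
    have := h2 o (set11 o) => e; have : g o \in porbit g o by apply/porbitP; exists 1%N;
      rewrite expg1.
    by rewrite e inE => /eqP.
  - by rewrite inE.
  - exact: h3.
  - by rewrite inE => zo; apply: h1; rewrite inE.
  - rewrite inE => /eqP ->; apply: porbit_fixed; apply: h1; by rewrite ?inE ?eqxx.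
  - exact: h3.
have go : g o = o.
  have /two_cyclesP[_ h2 _] := tg; have e := h2 o (set11 o).
  have : g o \in porbit g o by apply/porbitP; exists 1%N; rewrite expg1.
  by rewrite e inE => /eqP.
by rewrite (weight_fix_weight _ oN) fix_weight_mul // excise_mul.
Qed.

End Weights.

(** * Permutations as lists of cycles *)

Lemma picks_map (S U : Type) (f : S -> U) (L : seq S) :
  picks (map f L) = [seq (f q.1, map f q.2) | q <- picks L].
Proof.
elim: L => //= s L ->; congr (_ :: _); rewrite -!map_comp.
exact: eq_map.
Qed.

Lemma picks_perm (S : eqType) (L : seq S) q : q \in picks L -> perm_eq (q.1 :: q.2) L.
Proof.
elim: L q => //= s L IH q; rewrite inE => /orP[/eqP-> //|/mapP[r rL ->]] /=.
rewrite -(cat1s r.1) -(cat1s s) perm_catCA /= perm_cons; exact: IH.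
Qed.

Lemma sum_picks (S : Type) (F : S -> rat) (L : seq (seq S)) :
  \sum_(b <- flatten L) F b = \sum_(q <- picks L) \sum_(b <- q.1) F b.
Proof.
elim: L => [|s L IH] /=; first by rewrite !big_nil.
by rewrite big_cat big_cons big_map /= IH.
Qed.

Section CycleLists.
Variable T : finType.
Implicit Types (a g t : {perm T}) (N P Q M : {set T}) (z o b : T) (L : seq (seq T)).

(** [L] lists the cycles of [a] on [N], each as a sequence in cyclic order. Lists rather
    than sets of orbits make the cuts and joins below explicit, and [map size L] is the
    cycle type. *)
Definition cycle_list N a L : Prop :=
  [/\ all (fun s => s != [::]) L, all (fcycle a) L, perm_eq (flatten L) (enum N)
    & forall z, z \notin N -> a z = z].

Lemma path_mul a t z s : fpath a z s -> {in s, forall y, t y = y} -> fpath (a * t)%g z s.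
Proof.
elim: s z => //= y s IH z /andP[/eqP e h] ht.
rewrite permM e ht ?mem_head // eqxx; apply: IH => // w ws; apply: ht.
by rewrite inE ws orbT.
Qed.

Lemma cycle_mul a t s : fcycle a s -> {in s, forall y, t y = y} -> fcycle (a * t)%g s.
Proof.
case: s => //= z s; rewrite !rcons_path => /andP[h /eqP e] ht.
rewrite path_mul //=; last by move=> w ws; apply: ht; rewrite inE ws orbT.
by rewrite permM e ht ?mem_head.
Qed.

Lemma cycle_list_perm N a L L' : perm_eq L L' -> cycle_list N a L -> cycle_list N a L'.
Proof.
move=> pL [h1 h2 h3 h4]; split=> //; rewrite -?(perm_all _ pL) //.
by rewrite -(permPl (perm_flatten pL)).
Qed.

Lemma cycle_list_rot N a s r n : cycle_list N a (s :: r) -> cycle_list N a (rot n s :: r).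
Proof.
move=> [/= /andP[h1 h1'] /andP[h2 h2'] h3 h4]; split=> //=.
- by rewrite h1' andbT -size_eq0 size_rot size_eq0.
- by rewrite rot_cycle h2.
- by rewrite -(permPr h3) perm_cat2r perm_rot.
Qed.

Lemma enumD1 N o (X : seq T) : perm_eq (o :: X) (enum N) -> perm_eq X (enum (N :\ o)).
Proof.
move=> h; have := perm_uniq h; rewrite enum_uniq /= => /andP[oX uX].
apply: uniq_perm; rewrite ?enum_uniq // => z.
have := perm_mem h z; rewrite !mem_enum in_setD1 inE => <-.
by case: eqP => [->|_] //=; apply/negbTE.
Qed.

(** The common part of the three lemmas below: the cycles [r] avoid the support of [t], and
    the remaining ones [Y] are given. *)
Lemma cycle_list_core N a t o X Y r :
  perm_eq (o :: X ++ flatten r) (enum N) ->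
  all (fun s => s != [::]) r -> all (fcycle a) r -> (forall z, z \notin N -> a z = z) ->
  (forall y, y \notin o :: X -> t y = y) -> (a * t)%g o = o ->
  perm_eq (flatten Y) X -> all (fun s => s != [::]) Y -> all (fcycle (a * t)%g) Y ->
  cycle_list (N :\ o) (a * t)%g (Y ++ r).
Proof.
move=> pN r0 cr aN tX to pY Y0 cY.
have U : uniq (o :: X ++ flatten r) by rewrite (perm_uniq pN) enum_uniq.
split; rewrite ?all_cat ?Y0 ?cY //=.
- apply/allP => w wr; apply: cycle_mul (allP cr w wr) _ => y yw; apply: tX.
  have yr : y \in flatten r by apply/flattenP; exists w.
  move: U; rewrite /= mem_cat cat_uniq inE !negb_or => /andP[/andP[_ orr] /and3P[_ /hasPn hs _]].
  by rewrite hs // andbT; apply: contraNneq orr => <-.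
- by apply: enumD1; rewrite flatten_cat; apply: perm_trans pN; rewrite perm_cons perm_cat2r.
- move=> z; rewrite in_setD1 negb_and negbK => /orP[/eqP->|zN] //.
  rewrite permM aN // tX //; move: zN; rewrite -mem_enum -(perm_mem pN) !inE mem_cat.
  by rewrite !negb_or => /and3P[-> ->].
Qed.

Lemma tperm2_fix b c o y : y != b -> y != c -> y != o -> (tperm b o * tperm c o)%g y = y.
Proof. by move=> yb yc yo; rewrite permM !tpermD // eq_sym. Qed.

(** The element [b] following [o]: then [o] becomes a fixed point. *)
Lemma cycle_list_pop N a o c s r : cycle_list N a ((o :: c :: s) :: r) ->
  (a * tperm c o)%g o = o /\ cycle_list (N :\ o) (a * tperm c o)%g ((c :: s) :: r).
Proof.
move=> [/= r0 /andP[cs cr] pN aN].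
have U : uniq (o :: c :: s ++ flatten r) by rewrite (perm_uniq pN) enum_uniq.
move: cs; rewrite /= rcons_path => /and3P[/eqP ao ps /eqP cl].
have to : (a * tperm c o)%g o = o by rewrite permM ao tpermL.
split=> //; apply: (@cycle_list_core N a _ o (c :: s) [:: c :: s]) => //=.
- move=> y; rewrite !inE !negb_or => /and3P[yo yc _]; by rewrite tpermD // eq_sym.
- by rewrite cats0.
- rewrite andbT rcons_path /= permM cl tpermR eqxx andbT; apply: path_mul => // y ys.
  move: U; rewrite /= inE !mem_cat !negb_or => /and3P[/and3P[oc os _] /andP[cs _] _].
  by rewrite tpermD //; [apply: contraNneq cs => -> | apply: contraNneq os => ->].
Qed.

(** An element [b] further along the cycle of [o]: the cycle is cut in two. *)
Lemma cycle_list_split N a o c s b u r : cycle_list N a ((o :: c :: s ++ b :: u) :: r) ->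
  (a * tperm b o)%g o != o /\
  cycle_list (N :\ o) (excise (a * tperm b o)%g o) [:: c :: s, b :: u & r].
Proof.
move=> [/= r0 /andP[cs cr] pN aN].
have U : uniq (o :: c :: (s ++ b :: u) ++ flatten r) by rewrite (perm_uniq pN) enum_uniq.
move: cs; rewrite /= rcons_path cat_path last_cat /= => /and3P[/eqP ao /and3P[ps /eqP sb pu] /eqP
  uo].
have U' : uniq (o :: c :: b :: s ++ u).
  move: U; rewrite -!cat_cons cat_uniq => /and3P[h _ _]; move: h.
  by rewrite (perm_uniq (_ : perm_eq _ (o :: c :: b :: s ++ u))) // !perm_cons -cat1s perm_catCA.
move: U'; rewrite /= !inE !mem_cat !negb_or => /and4P[/and4P[oc ob os ou] /and3P[cb cs cu]
  /andP[bs bu] _].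
have ac : (a * tperm b o)%g o = c by rewrite permM ao tpermD // eq_sym.
split; first by rewrite ac eq_sym.
rewrite /excise ac -mulgA.
apply: (@cycle_list_core N a _ o (c :: s ++ b :: u) [:: c :: s; b :: u]) => //=.
- move=> y; rewrite !inE mem_cat inE !negb_or => /and5P[yo yc _ yb _]; exact: tperm2_fix.
- by rewrite mulgA permM ac tpermL.
- by rewrite cats0.
- rewrite !rcons_path /= andbT; apply/andP; split; apply/andP; split.
  + apply: path_mul => // y ys; apply: tperm2_fix.
    * by apply: contraNneq bs => <-.
    * by apply: contraNneq cs => <-.
    * by apply: contraNneq os => <-.
  + by rewrite mulgA permM [(a * _)%g _]permM sb tpermL tpermR.
  + apply: path_mul => // y ys; apply: tperm2_fix.
    * by apply: contraNneq bu => <-.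
    * by apply: contraNneq cu => <-.
    * by apply: contraNneq ou => <-.
  + by rewrite mulgA permM [(a * _)%g _]permM uo tpermR tpermD.
Qed.

(** An element [b] of another cycle: the two cycles are joined. *)
Lemma cycle_list_merge N a o s b u r :
  cycle_list N a ((o :: s) :: (b :: u) :: r) ->
  (a * tperm b o)%g o != o /\ cycle_list (N :\ o) (excise (a * tperm b o)%g o) ((s ++ b :: u) :: r).
Proof.
move=> [/= r0 /and3P[cs cu cr] pN aN].
have U : uniq (o :: b :: s ++ u).
  have : uniq (o :: (s ++ b :: u) ++ flatten r).
    by rewrite -catA (perm_uniq pN) enum_uniq.
  rewrite -cat_cons cat_uniq => /and3P[h _ _]; move: h.
  by rewrite (perm_uniq (_ : perm_eq _ (o :: b :: s ++ u))) // !perm_cons -cat1s perm_catCA.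
move: U; rewrite /= !inE !mem_cat !negb_or => /and3P[/and3P[ob os ou] /andP[bs bu] su].
move: cu; rewrite rcons_path => /andP[pu /eqP ub].
have pN' : perm_eq (o :: (s ++ b :: u) ++ flatten r) (enum N) by rewrite -catA.
case: s cs os bs su pN pN' => [|c s].
  rewrite /= andbT => /eqP ao _ _ _ _ pN.
  have ab : (a * tperm b o)%g o = b by rewrite permM ao tpermR.
  split; first by rewrite ab eq_sym.
  rewrite /excise ab -mulgA.
  apply: (@cycle_list_core N a _ o (b :: u) [:: b :: u]) => //=.
  - by move=> y _; rewrite tperm2 perm1.
  - by rewrite tperm2 mulg1.
  - by rewrite cats0.
  - by rewrite tperm2 mulg1 rcons_path /= pu ub eqxx.
rewrite /= !inE !negb_or rcons_path => /and3P[/eqP ao ps /eqP so] /andP[oc os] /andP[bc bs].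
rewrite mem_cat negb_or => /andP[/andP[cs cu] _] _ pN.
have ac : (a * tperm b o)%g o = c by rewrite permM ao tpermD // eq_sym.
split; first by rewrite ac eq_sym.
rewrite /excise ac -mulgA.
apply: (@cycle_list_core N a _ o (c :: s ++ b :: u) [:: c :: s ++ b :: u]) => //=.
- move=> y; rewrite !inE mem_cat inE !negb_or => /and5P[yo yc _ yb _]; exact: tperm2_fix.
- by rewrite mulgA permM ac tpermL.
- by rewrite cats0.
- rewrite rcons_path cat_path last_cat /= andbT.
  have cb : c != b by rewrite eq_sym.
  apply/andP; split; first (apply/and3P; split).
  + apply: path_mul => // y ys; apply: tperm2_fix.
    * by apply: contraNneq bs => <-.
    * by apply: contraNneq cs => <-.
    * by apply: contraNneq os => <-.
  + by rewrite mulgA permM [(a * _)%g _]permM so tpermR tpermD // eq_sym.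
  + apply: path_mul => // y ys; apply: tperm2_fix.
    * by apply: contraNneq bu => <-.
    * by apply: contraNneq cu => <-.
    * by apply: contraNneq ou => <-.
  + by rewrite mulgA permM [(a * _)%g _]permM ub tpermL tpermR.
Qed.

End CycleLists.

(** * Closed form for one cycle *)

Section OneCycleClosedForm.
Variable T : finType.
Implicit Types (a g t : {perm T}) (N P Q M : {set T}) (z o b : T) (L : seq (seq T)).
Variable x : rat.

Lemma cycle_list_swap N a s u r : cycle_list N a (s :: u :: r) -> cycle_list N a (u :: s :: r).
Proof. by apply: cycle_list_perm; rewrite -cat1s -(cat1s u) perm_catCA. Qed.

(** If the values [G] on the permutations of [N] minus [o] depend on the cycle type through
    [h], then the sum over [b] is given by [insertion_rec]: the three kinds of [b] are those
    of [cycle_list_pop], [cycle_list_split] and [cycle_list_merge]. *)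
Lemma insertion_rec_value (h : seq nat -> rat) (G : {perm T} -> rat) N a o s r :
  (forall u v, perm_eq u v -> h u = h v) -> (forall u, h (0%N :: u) = 0) ->
  (forall rho L, cycle_list (N :\ o) rho L -> G rho = h (map size L)) ->
  cycle_list N a ((o :: s) :: r) ->
  \sum_(b in N :\ o) fix_weight x (a * tperm b o)%g o * G (excise (a * tperm b o)%g o) =
  insertion_rec x h (size s).+1 (map size r).
Proof.
move=> hp h0 hG da.
have pN : perm_eq (s ++ flatten r) (enum (N :\ o)).
  by apply: enumD1; case: da => /= _ _ da3 _.
rewrite -big_enum /= -(perm_big _ pN) /= big_cat /= sum_picks /insertion_rec; congr (_ + _).
- case: s da {pN} => [|c s] da; first by rewrite big_nil h0 mulr0 add0r big_geq.
  rewrite big_cons; congr (_ + _).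
    have [e d] := cycle_list_pop da.
    by rewrite /fix_weight e eqxx excise_fix // (hG _ _ d).
  rewrite big_add1 /=.
  rewrite (big_nth o) big_mkord [RHS]big_mkord; apply: eq_bigr => i _.
  have es : s = take i s ++ nth o s i :: drop i.+1 s.
    by rewrite -drop_nth // cat_take_drop.
  have : cycle_list N a ((o :: c :: take i s ++ nth o s i :: drop i.+1 s) :: r) by rewrite -es.
  case/cycle_list_split => e d.
  rewrite /fix_weight (negPf e) mul1r (hG _ _ d) /= size_takel ?size_drop; last exact: ltnW.
  by rewrite subSS subnSK.
- rewrite picks_map big_map; apply: eq_big_seq => q qr /=.
  have dq : cycle_list N a ((o :: s) :: q.1 :: q.2).
    by apply: cycle_list_perm da; rewrite perm_cons perm_sym (picks_perm qr).
  rewrite (eq_big_seq (fun=> h ((size s + size q.1)%N :: map size q.2))).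
    by rewrite big_const_seq count_predT iter_addr_0 mulr_natl.
  move=> b bq; have [n u eu] := rot_to bq.
  have := cycle_list_swap (cycle_list_rot n (cycle_list_swap dq)); rewrite eu.
  case/cycle_list_merge => e d.
  by rewrite /fix_weight (negPf e) mul1r (hG _ _ d) /= size_cat -eu size_rot.
Qed.

Hypothesis x0 : x != 0.

(** A sum over points is a sum over cycles, each counted with its length, provided the
    summand at [o] depends only on the type of the decomposition around [o]. *)
Lemma sum_over_cycles N a L (F : T -> rat) (F' : nat -> seq nat -> rat) :
  cycle_list N a L ->
  (forall o s r, cycle_list N a ((o :: s) :: r) -> F o = F' (size s).+1 (map size r)) ->
  \sum_(o in N) F o = \sum_(q <- picks (map size L)) q.1%:R * F' q.1 q.2.
Proof.
move=> dL hF; have [_ _ pN _] := dL.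
rewrite -big_enum /= -(perm_big _ pN) /= sum_picks picks_map big_map.
apply: eq_big_seq => q qL /=.
rewrite (eq_big_seq (fun=> F' (size q.1) (map size q.2))).
  by rewrite big_const_seq count_predT iter_addr_0 mulr_natl.
move=> o oq; have [n u eu] := rot_to oq.
have : cycle_list N a (q.1 :: q.2) by apply: cycle_list_perm dL; rewrite perm_sym picks_perm.
move/(cycle_list_rot n); rewrite eu => /hF ->.
by rewrite -(size_rot n q.1) eu.
Qed.

Lemma cycle_list_card N a L : cycle_list N a L -> sumn (map size L) = #|N|.
Proof. by case=> _ _ pN _; rewrite -[map size L]/(shape L) -size_flatten (perm_size pN) cardE. Qed.

Lemma cycle_list_pos N a L : cycle_list N a L -> all (leq 1) (map size L).
Proof.
case=> h _ _ _; rewrite all_map; apply: sub_all h => s /=.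
by rewrite -size_eq0 lt0n.
Qed.

Lemma insertion_sumZ k h mu : insertion_sum x (fun s => k * h s) mu = k * insertion_sum x h mu.
Proof.
rewrite /insertion_sum mulr_sumr; apply: eq_bigr => q _; rewrite [RHS]mulrCA /insertion_rec;
  congr (_ * _).
rewrite !mulrDr [in LHS]mulrCA !mulr_sumr; congr (_ + _ + _).
by apply: eq_bigr => r _; rewrite mulrCA.
Qed.

Lemma cardD1_pred N o n : o \in N -> #|N| = n.+1 -> #|N :\ o| = n.
Proof. by move=> oN; rewrite (cardsD1 o) oN => -[]. Qed.

Lemma one_cycle_singleton N a L : cycle_list N a L -> #|N| = 1%N ->
  two_cycle_gf x 0 N a = colour_sum sign2 (one_cycle_coef x 1) (map size L).
Proof.
move=> dL N1; have sL := cycle_list_card dL; rewrite N1 in sL.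
have -> : map size L = [:: 1%N].
  move: (cycle_list_pos dL) sL; case: (map size L) => //= k r /andP[k0 r0] kr.
  case: r r0 kr => [_ /=|l r /= /andP[l0 _]]; first by rewrite addn0 => ->.
  lia.
have -> : a = 1%g.
  have [_ _ _ aN] := dL; have /cards1P[o No] : #|N| == 1%N by rewrite N1.
  apply/permP=> z; rewrite perm1; have [->|zo] := eqVneq z o; last by apply: aN; rewrite No inE.
  apply/eqP; apply: contraT => ao.
  have : a (a o) = a o by apply: aN; rewrite No inE.
  by move/perm_inj/eqP; rewrite (negPf ao).
rewrite /two_cycle_gf (eq_bigl (pred1 set0)); last first.
  by move=> P /=; rewrite cards_eq0 andbC; case: eqP => //= ->; rewrite sub0set.
rewrite big_pred1_eq setD0 (eq_bigl (pred1 1%g)); last first.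
  move=> g /=; have /cards1P[o No] : #|N| == 1%N by rewrite N1.
  apply/two_cyclesP/eqP => [[h _ _]|->].
    apply/permP=> z; rewrite perm1; have [->|zo] := eqVneq z o; last by apply: h; rewrite ?No inE.
    apply/eqP; apply: contraT => ao.
    have : g (g o) = g o by apply: h; rewrite ?No inE.
    by move/perm_inj/eqP; rewrite (negPf ao).
  split=> z; rewrite ?perm1 ?inE // No inE => /eqP ->.
  by apply: porbit_fixed; rewrite perm1.
rewrite big_pred1_eq mulg1 /weight.
have -> : #|porbits (1 : {perm T})%g| = #|~: N|.+1 by rewrite card_porbits1 -(cardsC N) N1.
rewrite exprS mulfK ?expf_neq0 //.
rewrite colour_sumS big_bool /colour_sum /shift_size /one_cycle_coef !ffunE /= /sign2 /gbin
  !big_ord_recl !big_ord0 /= !factS fact0.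
rewrite !natrM; by field.
Qed.

(** Induction on the number of points. The left side does not depend on the deleted point
    [o], so summing over [o] multiplies it by [#|N|]; the right side then becomes an
    [insertion_sum], which [one_cycle_step] evaluates. *)
Lemma one_cycle_closed_form n N a L : cycle_list N a L -> #|N| = n.+1 ->
  two_cycle_gf x 0 N a = n`!%:R * colour_sum sign2 (one_cycle_coef x n.+1) (map size L).
Proof.
elim: n N a L => [|n IH] N a L dL cN; first by rewrite mul1r; exact: one_cycle_singleton.
have E : \sum_(o in N) two_cycle_gf x 0 N a = n`!%:R * insertion_sum x (colour_sum sign2
  (one_cycle_coef x n.+1)) (map size L).
  rewrite -insertion_sumZ; apply: sum_over_cycles dL _ => o s r d.
  have oN : o \in N.
    by have [_ _ pN _] := d; rewrite -mem_enum -(perm_mem pN) /= mem_head.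
  have cD := cardD1_pred oN cN.
  rewrite (two_cycle_gf0_rec x0 a oN) ?cD //.
  apply: insertion_rec_value d; last by move=> rho L' d'; apply: IH.
    by move=> u v uv; rewrite (colour_sum_perm _ _ uv).
  by move=> u; rewrite colour_sum_part0 ?mulr0 //; exact: sign2_sum.
have := E; rewrite sumr_const one_cycle_step ?(cycle_list_card dL) //;
  last exact: cycle_list_pos dL.
rewrite cN => H; apply: (mulfI (natS_neq0 n.+1)).
by rewrite [LHS]mulr_natl H factS !natrM; ring.
Qed.

End OneCycleClosedForm.

(** * Closed form for two cycles *)

Lemma gbin1 r : gbin r 1 = r.
Proof. by rewrite gbinSr gbin0 mul1r subr0 divr1. Qed.

Definition big_only (n : {ffun bool -> nat}) : {ffun colours4 -> nat} :=
  [ffun j => if j.1 then n j.2 else 0%N].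

Lemma big_only0 : big_only [ffun=> 0%N] = [ffun=> 0%N].
Proof. by apply/ffunP=> -[[] s]; rewrite !ffunE. Qed.

Lemma big_only_add n s k : big_only (add_size n s k) = add_size (big_only n) (true, s) k.
Proof. by apply/ffunP=> -[[] s']; rewrite !ffunE. Qed.

Lemma small_size_big_only n : small_size (big_only n) = 0%N.
Proof. by rewrite /small_size !ffunE. Qed.

Lemma colour_sum4S C k r : colour_sum sign4 C (k :: r) =
  \sum_s sign2 s * colour_sum sign4 (shift_size (true, s) k C) r + \sum_s sign2 s * colour_sum
    sign4 (shift_size (false, s) k C) r.
Proof. by rewrite colour_sumS sum_colours4 !big_bool [RHS]addrC !addrA. Qed.

(** A part larger than [d] cannot be given a small colour. *)
Lemma colour_sum_no_small d C mu : all (leq d.+1) mu ->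
  (forall n : {ffun colours4 -> nat}, (d < small_size n)%N -> C n = 0) ->
  colour_sum sign4 C mu = colour_sum sign2 (fun n => C (big_only n)) mu.
Proof.
elim: mu C => [|k r IH] C; first by rewrite /colour_sum big_only0.
move=> /= /andP[dk dr] hC; rewrite colour_sum4S colour_sumS [X in _ + X]big1 ?addr0.
  apply: eq_bigr => s _; rewrite IH //; last by move=> n dn;
    rewrite /shift_size hC // small_size_add /= addn0.
  by congr (_ * _); apply: eq_colour_sum => n; rewrite /shift_size big_only_add.
move=> s _; rewrite (eq_colour_sum _ _ (d := fun=> 0)) ?colour_sum0 ?mulr0 // => n.
by rewrite /shift_size hC // small_size_add /= mul1n; lia.
Qed.

(** For coefficient functions supported on small totals at most 1, at most one part is
    small, and it has size 1. *)
Lemma colour_sum_one_small C mu : all (leq 1) mu ->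
  (forall n : {ffun colours4 -> nat}, (1 < small_size n)%N -> C n = 0) ->
  colour_sum sign4 C mu = colour_sum sign2 (fun n => C (big_only n)) mu
   + \sum_(q <- picks mu) (q.1 == 1%N)%:R *
      colour_sum sign2 (fun n => C (add_size (big_only n) (false, true) 1) - C (add_size
        (big_only n) (false, false) 1)) q.2.
Proof.
elim: mu C => [|k r IH] C; first by rewrite /colour_sum big_only0 big_nil addr0.
move=> /= /andP[k0 r0] hC; rewrite colour_sum4S colour_sumS big_cons big_map /=.
rewrite (eq_bigr (fun s => sign2 s * colour_sum sign2 (shift_size s k (fun n => C (big_only n))) r
   + \sum_(q <- picks r) (q.1 == 1%N)%:R * (sign2 s *
      colour_sum sign2 (fun n => C (add_size (add_size (big_only n) (false, true) 1) (true, s) k)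
                      - C (add_size (add_size (big_only n) (false, false) 1) (true, s) k))
                          q.2))); last first.
  move=> s _; rewrite IH //; last by move=> n dn; rewrite /shift_size hC // small_size_add /= addn0.
  rewrite mulrDr mulr_sumr; congr (_ * _ + _).
    by apply: eq_colour_sum => n; rewrite /shift_size big_only_add.
  by apply: eq_bigr => q _; rewrite mulrCA.
rewrite big_split -!addrA; congr (_ + _).
rewrite addrC exchange_big /=; congr (_ + _).
  case: (k =P 1%N) => [->|/eqP k1].
    rewrite mul1r big_bool /= /sign2 mul1r mulN1r.
    rewrite !(@colour_sum_no_small 0 (shift_size _ _ _)) //;
      try by move=> n; rewrite lt0n => n0; rewrite /shift_size hC // small_size_add /=; lia.
    rewrite colour_sumD; congr (_ + _).
    by rewrite -mulN1r -colour_sumZ; apply: eq_colour_sum => n; rewrite mulN1r.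
  rewrite mul0r big1 // => s _; rewrite (eq_colour_sum _ _ (d := fun=> 0)) ?colour_sum0 ?mulr0 //
    => n.
  by rewrite /shift_size hC // small_size_add /= mul1n; lia.
apply: eq_bigr => q _; rewrite colour_sumS -mulr_sumr; congr (_ * _).
apply: eq_bigr => s _; congr (_ * _); apply: eq_colour_sum => n.
by rewrite /shift_size big_only_add !(add_sizeAC _ (true, s)).
Qed.

Section TwoCycleClosedForm.
Variable T : finType.
Implicit Types (a g t : {perm T}) (N P Q M : {set T}) (z o b : T) (L : seq (seq T)).
Variable x : rat.

(** For [p = 1] the permutation [g] is a fixed point and a full cycle of the rest, so that
    the left side is known from the one-cycle case. At most one part of size 1 is small: it
    is the fixed point of [a] that [g] fixes as well. *)
Lemma two_cycle_coef_base m mu : all (leq 1) mu -> sumn mu = m.+1 ->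
  \sum_(q <- picks mu) q.1%:R * (if q.1 == 1%N then x * colour_sum sign2 (one_cycle_coef x m) q.2
                                else colour_sum sign2 (one_cycle_coef x m) (q.1.-1 :: q.2))
  = colour_sum sign4 (two_cycle_coef x 1 m) mu.
Proof.
move=> mu0 smu.
have posq q : q \in picks mu -> (0 < q.1)%N.
  by move=> /picks_perm pq; apply: (allP mu0); rewrite -(perm_mem pq) mem_head.
rewrite (colour_sum_one_small mu0); last by move=> n n1; rewrite /two_cycle_coef kernel_coef_hi.
rewrite (eq_big_seq (fun q => q.1%:R * colour_sum sign2 (one_cycle_coef x m) (q.1.-1 :: q.2)
    + (q.1 == 1%N)%:R * (x * colour_sum sign2 (one_cycle_coef x m) q.2))); last first.
  move=> q qm; case: eqP => [->|_]; last by rewrite mul0r addr0.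
  by rewrite colour_sum_part0 ?mulr0 ?add0r //; exact: sign2_sum.
rewrite big_split; congr (_ + _).
  transitivity (\sum_j colour_sum sign2 (fun n => (n j)%:R * one_cycle_coef x m (drop_size n j))
    mu).
    rewrite [RHS](eq_bigr (fun j => sign2 j * (sign2 j * colour_sum sign2 (fun n => (n j)%:R *
      one_cycle_coef x m (drop_size n j)) mu)));
      last by move=> j _; rewrite mulrA sign2_sq mul1r.
    under [RHS]eq_bigr do rewrite -(colour_sum_weight sign2_sq) mulr_sumr.
    rewrite exchange_big; apply: eq_big_seq => q qm.
    rewrite colour_sumS mulr_sumr; apply: eq_bigr => j _.
    rewrite mulrCA; congr (_ * (_ * _)); apply: eq_colour_sum => n.
    rewrite /shift_size; congr one_cycle_coef; apply/ffunP=> i; rewrite !ffunE.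
    have := posq q qm; case: (i == j) => /=; lia.
  rewrite -colour_sum_big; apply: eq_colour_sum_total => n; rewrite !big_bool smu /= => tot.
  rewrite /two_cycle_coef (@kernel_coef_le _ _ _ 1) ?small_size_big_only // !ffunE /= /kernel
    big_nat1 /one_cycle_coef !ffunE /= subn0.
  rewrite !addr0.
  rewrite gbin1; case: (n true) tot => [|a] tot.
    rewrite add0n in tot; rewrite tot !mulr0n mul0r add0r addr0 (gbinSl x m).
    by rewrite mulrC mulfVK ?natS_neq0.
  have {}tot : m = (n false + a)%N by apply: succn_inj; rewrite -[LHS]tot addSn addnC.
  have -> : (n false)%:R = m%:R - a%:R :> rat by rewrite tot natrD addrK.
  rewrite subn1 /=.
  have -> : x + a%:R = x + a.+1%:R - 1 by rewrite -natr1 addrA addrK.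
  rewrite (gbinSr (_ - 1)) (gbinSl (x + a.+1%:R)).
  by have := natS_neq0 m; rewrite -!natr1 => h; field.
apply: eq_bigr => q _; congr (_ * _); rewrite -colour_sumZ; apply: eq_colour_sum => n.
rewrite /two_cycle_coef !(@kernel_coef_le _ _ _ 0) ?small_size_add ?small_size_big_only // !ffunE
  /= /kernel.
rewrite /one_cycle_coef !addr0 -mulrBl; congr (_ * _).
  by rewrite -[LHS](gbin1 x) -gbin_diff.
by rewrite mul0n addn0.
Qed.

Lemma mem_cycle_list N a o s r : cycle_list N a ((o :: s) :: r) -> o \in N.
Proof. by case=> _ _ pN _; rewrite -mem_enum -(perm_mem pN) /= mem_head. Qed.

Lemma cycle_list_drop N a o r : cycle_list N a ([:: o] :: r) -> a o = o /\ cycle_list (N :\ o) a r.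
Proof.
move=> [/= r0 /andP[/andP[/eqP ao _] cr] pN aN]; split=> //; split=> //.
  exact: enumD1.
move=> z; rewrite in_setD1 negb_and negbK => /orP[/eqP->|/aN] //.
Qed.

Hypothesis x0 : x != 0.

(** Induction on [p], for all [m] at once: [two_cycle_gf_rec] gives the value for [p + 1]
    from the values for [p], and [two_cycle_step] shows that the proposed values satisfy the
    same relation. *)
Lemma two_cycle_closed_form p m N a L : cycle_list N a L -> #|N| = (p.+1 + m.+1)%N ->
  two_cycle_gf x p.+1 N a = (p`! * m`!)%:R * colour_sum sign4 (two_cycle_coef x p.+1 m.+1) (map
    size L).
Proof.
elim: p m N a L => [|p IH] m N a L dL cN.
  rewrite two_cycle_gf1 //; last by rewrite cN; lia.
  rewrite -two_cycle_coef_base; first last.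
  - by rewrite (cycle_list_card dL) cN.
  - exact: cycle_list_pos dL.
  rewrite mul1n mulr_sumr.
  rewrite (@sum_over_cycles _ N a L _ (fun k r => m`!%:R * (if k == 1%N then x * colour_sum sign2
    (one_cycle_coef x m.+1) r
       else colour_sum sign2 (one_cycle_coef x m.+1) (k.-1 :: r)))) //.
    by apply: eq_bigr => q _; rewrite mulrCA.
  move=> o s r d; have oN := mem_cycle_list d.
  have cD := cardD1_pred oN cN.
  case: s d => [|c s] d.
    have [ao d'] := cycle_list_drop d.
    by rewrite /fix_weight ao eqxx excise_fix // (one_cycle_closed_form x0 d' cD) mulrCA.
  have [_ d'] := cycle_list_pop d.
  have [_ /andP[/= /andP[/eqP ao _] _] pN _] := d.
  have co : c != o.
    have := perm_uniq pN; rewrite enum_uniq /= inE => /andP[/norP[+ _] _].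
    by rewrite eq_sym.
  rewrite /fix_weight ao (negPf co) mul1r /excise ao (one_cycle_closed_form x0 d' cD).
  by [].
have E : \sum_(o in N) \sum_(b in N :\ o)
     fix_weight x (a * tperm b o)%g o * two_cycle_gf x p.+1 (N :\ o) (excise (a * tperm b o)%g o)
  = (p`! * m`!)%:R * insertion_sum x (colour_sum sign4 (two_cycle_coef x p.+1 m.+1)) (map size L).
  rewrite -insertion_sumZ; apply: sum_over_cycles dL _ => o s r d.
  have cD := cardD1_pred (mem_cycle_list d) cN.
  apply: insertion_rec_value d; last by move=> rho L' d'; apply: IH.
    by move=> u v uv; rewrite (colour_sum_perm _ _ uv).
  by move=> u; rewrite colour_sum_part0 ?mulr0 //; exact: sign4_sum.
have cN' : #|N| = (p.+1 + m.+1).+1 by rewrite cN.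
have H := two_cycle_gf_rec x0 a (ltn0Sn p) (ltn0Sn m) cN'.
rewrite {}E two_cycle_step // in H; [|exact: cycle_list_pos dL|by rewrite (cycle_list_card dL)].
rewrite (IH m.+1 _ _ _ dL) in H; last by rewrite cN; lia.
apply: (mulfI (natS_neq0 p.+1)).
have {}H := canRL (addKr _) H; rewrite H.
rewrite !factS !natrM; ring.
Qed.

End TwoCycleClosedForm.

(** * Cycle types, conjugacy and existence *)

Section Types.
Variable T : finType.
Implicit Types (a g t : {perm T}) (N P Q M : {set T}) (z o b : T) (L : seq (seq T)).

Lemma porbit_fconnect a z y : (y \in porbit a z) = fconnect a z y.
Proof.
apply/porbitP/idP => [[i ->]|h].
  by rewrite permX; apply: fconnect_iter.
by exists (findex a z y); rewrite permX iter_findex.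
Qed.

Lemma cycle_list_exists a : exists L, cycle_list [set: T] a L.
Proof.
suff H n N : #|N| = n -> (forall z, (a z \in N) = (z \in N)) ->
   exists L, [/\ all (fun s => s != [::]) L, all (fcycle a) L & perm_eq (flatten L) (enum N)].
  have [z|L [h1 h2 h3]] := H _ [set: T] erefl; first by rewrite !inE.
  by exists L; split=> // z; rewrite inE.
elim/ltn_ind: n N => n IH N cN clN.
have [N0|[z zN]] := set_0Vmem N.
  by exists [::]; split=> //=; rewrite N0 enum_set0.
have cl y : fconnect a z y -> y \in N.
  by move=> /iter_findex <-; elim: (findex _ _ _) => //= i IHi; rewrite clN.
pose M := N :\: [set y in fingraph.orbit a z].
have inM y : (y \in M) = (y \notin fingraph.orbit a z) && (y \in N) by rewrite !inE.
have [||L [h1 h2 h3]] := IH #|M| _ M erefl.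
- rewrite -cN; apply: proper_card; apply/properP; split; first exact: subsetDl.
  by exists z => //; rewrite inM fingraph.in_orbit.
- move=> y; rewrite !inM clN -!fconnect_orbit.
  by rewrite -(same_fconnect1_r (@perm_inj _ a) z y).
exists (fingraph.orbit a z :: L); split=> /=.
- by rewrite h1 andbT; apply/eqP => e; have := fingraph.in_orbit a z; rewrite e.
- by rewrite h2 cycle_orbit //; exact: perm_inj.
apply: uniq_perm; rewrite ?enum_uniq //.
  rewrite cat_uniq fingraph.orbit_uniq (perm_uniq h3) enum_uniq andbT /=.
  by apply/hasPn => y; rewrite (perm_mem h3) mem_enum inM => /andP[].
move=> y; rewrite mem_cat (perm_mem h3) !mem_enum inM.
have [yo|] //= := boolP (y \in fingraph.orbit a z).
by symmetry; apply: cl; rewrite fconnect_orbit.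
Qed.

Lemma cycle_list_type a L : cycle_list [set: T] a L ->
  perm_eq [seq #|C| | C : {set T} in porbits a] (map size L).
Proof.
case=> h1 h2 h3 _.
have U : uniq (flatten L) by rewrite (perm_uniq h3) enum_uniq.
have us s : s \in L -> uniq s.
  by move=> sL; move: U; case/splitPr: sL => L1 L2;
    rewrite flatten_cat /= cat_uniq cat_uniq => /and3P[_ _ /and3P[]].
have por s z : s \in L -> z \in s -> porbit a z = [set y in s].
  move=> sL zs; apply/setP=> y; rewrite porbit_fconnect inE.
  have cs : fcycle a s := allP h2 s sL.
  by rewrite (fconnect_cycle cs zs).
have -> : map size L = map (fun C : {set T} => #|C|) (map (fun s => [set y in s]) L).
  rewrite -map_comp; apply/eq_in_map => s sL /=; rewrite cardsE; apply/esym/card_uniqP.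
  exact: us.
apply: perm_map; apply: uniq_perm; rewrite ?enum_uniq //.
  elim: (L) h1 U => //= s r IH /andP[s0 r0]; rewrite cat_uniq => /and3P[_ /hasPn hs ur].
  rewrite IH // andbT; apply/mapP => -[w wr e].
  case: s s0 hs e => // z s _ hs e.
  have zw : z \in w.
    have : z \in [set y in z :: s] by rewrite inE mem_head.
    by rewrite e inE.
  have zr : z \in flatten r by apply/flattenP; exists w.
  by have := hs z zr; rewrite /= mem_head.
move=> C; rewrite mem_enum; apply/imsetP/mapP => [[z _ ->]|[s sL ->]].
  have : z \in flatten L by rewrite (perm_mem h3) mem_enum inE.
  by case/flattenP => s sL zs; exists s => //; rewrite (por _ _ sL zs).
have s0 := allP h1 s sL.
have [z zs] : exists z, z \in s by case: (s) s0 => // z s' _; exists z; exact: mem_head.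
by exists z => //; rewrite (por _ _ sL zs).
Qed.

Lemma map_nth_index (S : eqType) (s s' : seq S) : uniq s -> size s = size s' ->
  map (fun y => nth y s' (index y s)) s = s'.
Proof.
case: s => [|z0 s] us es; first by case: s' es.
apply: (@eq_from_nth _ z0); rewrite size_map // => i si.
rewrite (nth_map z0) // index_uniq //; apply: set_nth_default.
by rewrite -es.
Qed.

(** Listing the points of both permutations cycle by cycle, the map sending the points of
    one list to the points of the other in order conjugates them. *)
Lemma cycle_list_conj_exists a a' L L' : cycle_list [set: T] a L -> cycle_list [set: T] a' L' ->
  map size L = map size L' -> exists h : {perm T}, a' = (a ^ h)%g.
Proof.
move=> [_ c1' p1 _] [_ c2' p2 _] es.
have u1 : uniq (flatten L) by rewrite (perm_uniq p1) enum_uniq.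
have u2 : uniq (flatten L') by rewrite (perm_uniq p2) enum_uniq.
have m1 z : z \in flatten L by rewrite (perm_mem p1) mem_enum inE.
have m2 z : z \in flatten L' by rewrite (perm_mem p2) mem_enum inE.
have sz : size (flatten L) = size (flatten L') by rewrite !size_flatten /shape es.
pose f z := nth z (flatten L') (index z (flatten L)).
have fi : injective f.
  move=> y z; rewrite /f => e; apply: (index_inj y (m1 y) (m1 z)).
  have iy : (index y (flatten L) < size (flatten L'))%N by rewrite -sz index_mem.
  have iz : (index z (flatten L) < size (flatten L'))%N by rewrite -sz index_mem.
  by apply/eqP; rewrite -(nth_uniq y iy iz u2) e (set_nth_default z).
exists (perm fi).
have mf : map (perm fi) (flatten L) = flatten L'.
  by rewrite -(map_nth_index u1 sz); apply: eq_map => z; rewrite permE.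
have mL : map (map (perm fi)) L = L'.
  by rewrite -(flattenK L') -mf /shape -es -[map size L]/(shape L) -map_reshape flattenK.
apply/permP=> y; set h := perm fi in mL *.
have [z ->] : exists z, y = h z by exists ((h^-1)%g y); rewrite permKV.
rewrite permJ; have /flattenP[s sL zs] := m1 z.
have us : uniq s by move: u1; case/splitPr: sL => L1 L2;
  rewrite flatten_cat /= cat_uniq cat_uniq => /and3P[_ _ /and3P[]].
have hsL : map h s \in L' by rewrite -mL map_f.
have /eqP := next_cycle (allP c1' s sL) zs; rewrite /= => ->.
have hz : h z \in map h s by rewrite map_f.
have /eqP := next_cycle (allP c2' _ hsL) hz; rewrite /= => ->.
by rewrite next_map //; exact: perm_inj.
Qed.

Lemma perm_map_size L (mu : seq nat) : perm_eq (map size L) mu ->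
  exists2 L', perm_eq L L' & map size L' = mu.
Proof.
elim: mu L => [|k r IH] L.
  by move/perm_nilP; case: L => // _; exists [::].
move=> pm; have /mapP[s sL ek] : k \in map size L by rewrite (perm_mem pm) mem_head.
have pL := perm_to_rem sL.
have [|L' pL' eL'] := IH (rem s L).
  by move: pm; rewrite (permPl (perm_map size pL)) /= -ek perm_cons.
exists (s :: L'); last by rewrite /= eL' -ek.
by rewrite (permPl pL) perm_cons.
Qed.

Lemma same_type_conj a a' :
  perm_eq [seq #|C| | C : {set T} in porbits a] [seq #|C| | C : {set T} in porbits a'] ->
  exists h : {perm T}, a' = (a ^ h)%g.
Proof.
have [L d] := cycle_list_exists a; have [L' d'] := cycle_list_exists a'.
rewrite (permPl (cycle_list_type d)) (permPr (cycle_list_type d')) => pm.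
have [M pM eM] := perm_map_size pm.
exact: cycle_list_conj_exists (cycle_list_perm pM d) d' eM.
Qed.

Lemma cycle_list_conj a L h : cycle_list [set: T] a L -> cycle_list [set: T] (a ^ h)%g (map (map
  h) L).
Proof.
move=> [h1 h2 h3 h4]; split.
- by rewrite all_map; apply: sub_all h1 => -[].
- rewrite all_map; apply: sub_all h2 => s /= cs; rewrite cycle_map.
  by apply: sub_cycle cs => u v /=; rewrite permJ (inj_eq perm_inj).
- rewrite -map_flatten; apply: uniq_perm.
  + by rewrite map_inj_uniq ?(perm_uniq h3) ?enum_uniq //; exact: perm_inj.
  + exact: enum_uniq.
  + move=> z; rewrite mem_enum inE; apply/mapP; exists ((h^-1)%g z); last by rewrite permKV.
    by rewrite (perm_mem h3) mem_enum inE.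
- by move=> z; rewrite inE.
Qed.

Lemma type_conj a h :
  perm_eq [seq #|C| | C : {set T} in porbits (a ^ h)%g] [seq #|C| | C : {set T} in porbits a].
Proof.
have [L d] := cycle_list_exists a.
rewrite (permPl (cycle_list_type (cycle_list_conj h d))) (permPr (cycle_list_type d)).
by rewrite -map_comp (eq_map (g := size)) // => s /=; rewrite size_map.
Qed.

Lemma card_porbits_conj a h : #|porbits (a ^ h)%g| = #|porbits a|.
Proof. by have := perm_size (type_conj a h); rewrite !size_map -!cardE. Qed.

Lemma type_inv a :
  [seq #|C| | C : {set T} in porbits (a^-1)%g] = [seq #|C| | C : {set T} in porbits a].
Proof. by rewrite porbitsV. Qed.

Lemma cycle_list_single N a o r : o \notin N -> cycle_list N a r -> cycle_list (o |: N) a ([:: o]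
  :: r).
Proof.
move=> oN [h1 h2 h3 h4]; split=> //=.
- by rewrite h4 // eqxx h2.
- apply: uniq_perm; rewrite /= ?enum_uniq // ?(perm_uniq h3) ?(perm_mem h3) ?mem_enum ?oN
    ?enum_uniq //.
  by move=> z; rewrite inE (perm_mem h3) !mem_enum in_setU1.
- by move=> z; rewrite in_setU1 negb_or => /andP[_ /h4].
Qed.

Lemma cycle_list_insert N a o c s r : o \notin N -> cycle_list N a ((c :: s) :: r) ->
  cycle_list (o |: N) (a * tperm c o)%g ((o :: c :: s) :: r).
Proof.
move=> oN [/= h1 /andP[cs cr] h3 h4].
have U : uniq (c :: s ++ flatten r) by rewrite (perm_uniq h3) enum_uniq.
have oX : o \notin c :: s ++ flatten r by rewrite (perm_mem h3) mem_enum.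
have fixt y : y \in s ++ flatten r -> tperm c o y = y.
  move=> ys; rewrite tpermD //.
    by apply: contraTneq ys => <-; case/andP: U.
  by apply: contraNneq oX => ->; rewrite inE ys orbT.
move: cs; rewrite rcons_path => /andP[ps /eqP cl].
split=> //=.
- rewrite permM h4 // tpermR eqxx rcons_path /= permM cl tpermL eqxx andbT.
  rewrite path_mul //=; last by move=> y ys; apply: fixt; rewrite mem_cat ys.
  apply/allP => w wr; apply: cycle_mul (allP cr w wr) _ => y yw; apply: fixt.
  by rewrite mem_cat; apply/orP; right; apply/flattenP; exists w.
- apply: uniq_perm; rewrite /= ?enum_uniq //.
    by move: oX U => /= -> ->.
  by move=> z; rewrite inE (perm_mem h3) !mem_enum in_setU1.
- move=> z; rewrite in_setU1 negb_or => /andP[zo zN]; rewrite permM h4 // tpermD //.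
    by apply: contraNneq zN => <-; rewrite -mem_enum -(perm_mem h3) mem_head.
  by rewrite eq_sym.
Qed.

Lemma exists_type (mu : seq nat) N : all (leq 1) mu -> sumn mu = #|N| ->
  exists a, exists2 L, cycle_list N a L & map size L = mu.
Proof.
have [n] := ubnP #|N|; elim: n mu N => // n IH mu N.
case: mu => [|k r] cN.
  move=> _ /esym/cards0_eq ->; exists 1%g; exists [::] => //; split=> //=.
    by rewrite enum_set0.
  by move=> z _; rewrite perm1.
move=> /= /andP[k0 r0] e.
have [o oN] : exists o, o \in N by apply/set0Pn; rewrite -card_gt0 -e; lia.
have cD : #|N| = #|N :\ o|.+1 by rewrite (cardsD1 o) oN.
have oD : o \notin N :\ o by rewrite setD11.
case: k k0 e => // -[|k] _ e.
  have [|||a [L dL eL]] := IH r (N :\ o) => //; first by lia.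
    by lia.
  by exists a; exists ([:: o] :: L); [rewrite -(setD1K oN);
    apply: cycle_list_single | rewrite /= eL].
have [|||a [L dL eL]] := IH (k.+1 :: r) (N :\ o) => //; first by lia.
  by rewrite /=; lia.
case: L dL eL => // -[|c s] L //= dL [es eL].
exists (a * tperm c o)%g; exists ((o :: c :: s) :: L); last by rewrite /= es eL.
by rewrite -(setD1K oN); apply: cycle_list_insert.
Qed.

End Types.

(** * Exchanging the two conjugacy classes *)

Lemma gbin_nat n m : gbin n%:R m = 'C(n, m)%:R.
Proof.
elim: n m => [|n IH] [|m]; rewrite ?gbin0 //; first by rewrite gbinSl mul0r mul0r.
by rewrite -natr1 gbin_pascal !IH binS natrD.
Qed.

(** With all parts above [p], only the big colours survive; then [X = x], and [q] equals
    [p]. *)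
Lemma two_cycle_coef_big_parts x p m mu : all (leq p.+2) mu ->
  colour_sum sign4 (two_cycle_coef x p.+1 m) mu =
  colour_sum sign2 (fun n => \sum_(0 <= i < p.+1) gbin (x + i%:R) p.+1
                    * gbin (x + (n true)%:R + i%:R - p.+1%:R) m) mu.
Proof.
move=> hmu; rewrite (colour_sum_no_small hmu).
  by apply: eq_colour_sum => n; rewrite /two_cycle_coef /kernel_coef small_size_big_only /kernel
    subn0 !ffunE /= addr0.
by move=> n hn; rewrite /two_cycle_coef /kernel_coef leqNgt hn.
Qed.

Section Count.
Variable T : finType.
Implicit Types (a g : {perm T}) (N P : {set T}).

(** At [x = 1] the sum counts the permutations and forgets [a], so [a] may be taken to be a
    single cycle. Its colour sum then reduces to one binomial coefficient. *)
Lemma two_cycle_gf_count p m N a : #|N| = (p.+1 + m.+1)%N ->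
  two_cycle_gf 1 p.+1 N a = (p`! * m`! * 'C(p.+1 + m.+1, m.+1))%:R.
Proof.
move=> cN.
have [||b [L dL eL]] := @exists_type T [:: (p.+1 + m.+1)%N] N => //.
  by rewrite /= addn0.
have -> : two_cycle_gf 1 p.+1 N a = two_cycle_gf 1 p.+1 N b.
  by apply: eq_bigr => P _; apply: eq_bigr => g _; rewrite /weight !expr1n.
rewrite (two_cycle_closed_form (oner_neq0 _) dL cN) eL [RHS]natrM; congr (_ * _).
rewrite two_cycle_coef_big_parts; last by rewrite /= andbT; lia.
rewrite colour_sumS big_bool /= /colour_sum /shift_size /sign2 /= !ffunE /= mul0n mul1n !add0n
  mul1r mulN1r -sumrB.
rewrite big_nat_recr //= big_nat_cond big1 ?add0r => [|i /andP[/andP[_ ip] _]].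
  rewrite nat1r !gbin_nat binn !mul1r.
  have -> : 1 + (p.+1 + m.+1)%:R + p%:R - p.+1%:R = (p.+1 + m.+1)%:R :> rat.
    by rewrite -(natr1 p); ring.
  have b0 : gbin (0 : rat) m.+1 = 0 by rewrite gbinSl !mul0r.
  by rewrite subrr b0 subr0 gbin_nat.
by rewrite nat1r gbin_nat bin_small ?mul0r ?subrr // ltnS.
Qed.

End Count.

Section Classes.
Variable n : nat.
Implicit Types (a g : 'S_n).

Lemma class_conj la a g : a \in cycle_class n la -> g \in cycle_class n la ->
  exists h : 'S_n, g = (a ^ h)%g.
Proof.
rewrite !inE => ha hg; apply: same_type_conj.
by rewrite (permPl ha) perm_sym.
Qed.

Lemma class_closed la a (h : 'S_n) : ((a ^ h)%g \in cycle_class n la) = (a \in cycle_class n la).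
Proof. by rewrite !inE (permPl (type_conj a h)). Qed.

(** The function of [g] on the left is invariant under conjugation. *)
Lemma sum_class_const (la : seq nat) mu (F : nat -> rat) g g' :
  g \in cycle_class n la -> g' \in cycle_class n la ->
  \sum_(a in cycle_class n mu) F (ncycles (a * g)%g) =
  \sum_(a in cycle_class n mu) F (ncycles (a * g')%g).
Proof.
move=> hg hg'; have [h ->] := class_conj hg hg'.
rewrite [RHS](reindex_inj (conjg_inj h)) /=.
apply: eq_big => [a|a _]; first by rewrite class_closed.
by rewrite -conjMg /ncycles card_porbits_conj.
Qed.

Lemma two_cycles_type (P : {set 'I_n}) g : P != set0 -> ~: P != set0 -> two_cycles P (~: P) g ->
  perm_eq [seq #|C| | C : {set 'I_n} in porbits g] [:: #|P|; #|~: P|].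
Proof.
move=> P0 Q0 /two_cyclesP[_ h1 h2].
rewrite -[X in perm_eq _ X]/(map (fun C : {set 'I_n} => #|C|) [:: P; ~: P]).
apply: perm_map; apply: uniq_perm; rewrite ?enum_uniq //=.
  rewrite inE andbT; apply: contraNneq P0 => e.
  by rewrite -(setIid P) {2}e setICr.
move=> C; rewrite mem_enum !inE; apply/imsetP/orP => [[z _ ->]|].
  have [zP|zP] := boolP (z \in P); first by left; rewrite h1.
  by right; rewrite h2 // inE.
case=> /eqP->.
  by case/set0Pn: P0 => z zP; exists z; rewrite ?h1.
by case/set0Pn: Q0 => z zP; exists z; rewrite ?h2.
Qed.

(** Double counting over the pairs [(alpha, gamma)]: the sum over [alpha] is constant in
    [gamma], the sum over [gamma] is constant in [alpha], and each is multiplied by the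
    number of terms of the other. Marking one of the cycles of [gamma] removes the special
    case [p = m]. *)
Lemma class_sum x p m mu g : x != 0 -> n = (p.+1 + m.+1)%N ->
  g \in cycle_class n [:: p.+1; m.+1] ->
  'C(n, m.+1)%:R * (\sum_(a in cycle_class n mu) x ^+ ncycles (a * g)%g) =
  #|cycle_class n mu|%:R * colour_sum sign4 (two_cycle_coef x p.+1 m.+1) mu.
Proof.
move=> x0 en hg.
set A := \sum_(a in _) _.
have cN : #|[set: 'I_n]| = (p.+1 + m.+1)%N by rewrite cardsT card_ord.
have wtT (y : rat) b : weight y [set: 'I_n] b = y ^+ ncycles b.
  by rewrite /weight setCT cards0 expr0 divr1.
have E1 : \sum_(a in cycle_class n mu) two_cycle_gf x p.+1 [set: 'I_n] a =
   #|cycle_class n mu|%:R * ((p`! * m`!)%:R * colour_sum sign4 (two_cycle_coef x p.+1 m.+1) mu).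
  rewrite (eq_bigr (fun=> (p`! * m`!)%:R * colour_sum sign4 (two_cycle_coef x p.+1 m.+1) mu)).
    by rewrite sumr_const [RHS]mulr_natl.
  move=> a; rewrite inE => ha; have [L dL] := cycle_list_exists a.
  rewrite (two_cycle_closed_form x0 dL cN); congr (_ * _); apply: colour_sum_perm.
  by rewrite -(permPl (cycle_list_type dL)).
have E2 : \sum_(a in cycle_class n mu) two_cycle_gf x p.+1 [set: 'I_n] a
   = two_cycle_gf 1 p.+1 [set: 'I_n] 1%g * A.
  rewrite /two_cycle_gf exchange_big mulr_suml; apply: eq_bigr => P /andP[_ /eqP cP] /=.
  rewrite exchange_big mulr_suml; apply: eq_bigr => b tb /=.
  rewrite wtT expr1n mul1r /A; under eq_bigr do rewrite wtT.
  apply: (@sum_class_const [:: p.+1; m.+1] mu (fun k => x ^+ k)) => //.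
  move: tb; rewrite setTD => tb.
  have cQ : #|~: P| = m.+1 by have h := cardsC P; rewrite cP card_ord in h; lia.
  rewrite inE -[X in X :: _]cP -[X in [:: _; X]]cQ; apply: two_cycles_type => //.
    by rewrite -card_gt0 cP.
  by rewrite -card_gt0 cQ.
have := E2; rewrite E1 (two_cycle_gf_count _ cN) -en => h.
have f0 : (p`! * m`!)%:R != 0 :> rat by rewrite natrM mulf_neq0 ?fact_neq0.
apply: (mulfI f0); rewrite mulrA -natrM -{}h; ring.
Qed.
End Classes.

(** * Transitivity and the polynomial formula *)

Definition conv (V : {poly rat}) (h : nat -> rat) m : rat := \sum_(j < m.+1) V`_j * h (m - j)%N.

(** Multiplying the series [(1 + y)^r] by [1 + y] replaces [r] by [r + 1]: this is Pascal's
    rule. *)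
Lemma conv_X V y m : conv ((1 + 'X) * V) (gbin y) m = conv V (gbin (y + 1)) m.
Proof.
have E : conv ((1 + 'X) * V) (gbin y) m = conv V (gbin y) m + conv ('X * V) (gbin y) m.
  by rewrite /conv -big_split; apply: eq_bigr => j _; rewrite mulrDl mul1r coefD mulrDl.
rewrite {}E [X in _ + X]/conv big_ord_recl coefXM mul0r add0r.
case: m => [|m].
  by rewrite big_ord0 addr0 /conv !big_ord_recl !big_ord0 /= !gbin0.
rewrite /conv big_ord_recr [RHS]big_ord_recr /= subnn !gbin0 addrAC; congr (_ + _).
rewrite -big_split; apply: eq_bigr => j _ /=.
by rewrite coefXM /= subSS -mulrDr subSn ?gbin_pascal // -ltnS.
Qed.

Lemma conv_Xn V k y m : conv ((1 + 'X) ^+ k * V) (gbin y) m = conv V (gbin (y + k%:R)) m.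
Proof.
elim: k y => [|k IH] y; first by rewrite expr0 mul1r mulr0n addr0.
by rewrite exprS -mulrA conv_X IH -addrA nat1r.
Qed.

(** Each part [k] contributes [(1 + y)^k] when its colour is positive and [-1] when it is
    negative. *)
Lemma colour_sum_gbin mu y m :
  colour_sum sign2 (fun n => gbin (y + (n true)%:R) m) mu = conv (\prod_(k <- mu) ((1 + 'X) ^+ k
    - 1)) (gbin y) m.
Proof.
elim: mu y => [|k r IH] y.
  rewrite /colour_sum ffunE mulr0n addr0 /conv big_nil big_ord_recl coef1 mul1r subn0 big1 ?addr0
    // => j _.
  by rewrite coef1 mul0r.
rewrite colour_sumS big_bool big_cons /= mulrBl mul1r mul1r mulN1r.
have -> : forall V U (h : nat -> rat), conv (V - U) h m = conv V h m - conv U h m.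
  by move=> V U h; rewrite /conv -sumrB; apply: eq_bigr => j _; rewrite coefB mulrBl.
rewrite conv_Xn -!IH; congr (_ - _); apply: eq_colour_sum => n; rewrite /shift_size ffunE /=.
  by rewrite mul1n natrD addrA addrAC.
by rewrite addn0.
Qed.

Lemma horner_binom_shift c m x : (binom_shift c m).[x] = gbin (x + c%:~R) m.
Proof.
rewrite /binom_shift /gbin hornerZ mulrC horner_prod; congr (_ / _).
by apply: eq_bigr => j _; rewrite -polyC_natr -polyCMz !hornerE.
Qed.

Lemma calV_poly mu j : calV {poly rat} mu j = (calV rat mu j)%:P.
Proof.
rewrite /calV -coef_map /=; congr ((polyseq _)`_ _).
rewrite rmorph_prod; apply: eq_bigr => k _.
by rewrite rmorphB rmorphXn rmorphD /= rmorph1 map_polyX.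
Qed.

Lemma two_cycle_coef_calV x p m mu : all (leq p.+2) mu ->
  colour_sum sign4 (two_cycle_coef x p.+1 m) mu =
  (fps_mul (calV {poly rat} mu)
     (fun m => \sum_(0 <= i < p.+1) binom_shift i%:Z p.+1 * pow_shift (i%:Z - p.+1%:Z) m) m).[x].
Proof.
move=> hmu; rewrite two_cycle_coef_big_parts // colour_sum_big /fps_mul horner_sum.
under eq_bigr => i _.
  rewrite colour_sumZ (eq_colour_sum _ (d := fun n => gbin (x + i%:R - p.+1%:R + (n true)%:R)
    m)); last first.
    by move=> n; congr (gbin _ _); ring.
  rewrite colour_sum_gbin /conv mulr_sumr.
  over.
rewrite exchange_big; apply: eq_bigr => j _ /=.
rewrite hornerM calV_poly hornerC horner_sum mulr_sumr; apply: eq_bigr => i _.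
rewrite hornerM /pow_shift !horner_binom_shift mulrCA; congr (_ * (_ * gbin _ _)).
by rewrite rmorphB addrA.
Qed.

Lemma poly_eq_nonzero (P Q : {poly rat}) : (forall x, x != 0 -> P.[x] = Q.[x]) -> P = Q.
Proof.
move=> h; apply/eqP; rewrite -subr_eq0; apply: contraT => D0.
pose rs := [seq i.+1%:R : rat | i <- iota 0 (size (P - Q))].
have := max_poly_roots (rs := rs) D0; rewrite size_map size_iota ltnn => -> //.
  by apply/allP => _ /mapP[i _ ->]; rewrite rootE hornerD hornerN h ?subrr ?natS_neq0.
by rewrite map_inj_uniq ?iota_uniq // => i j /eqP; rewrite eqr_nat => /eqP [].
Qed.

Section Transitive.
Variables (n p : nat) (mu : seq nat).
Hypothesis hmup : forall m : nat, m \in mu -> (p + 1 <= m)%N.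

(** The orbit of a point [y] of the [p]-cycle contains its cycle under [a], which has more
    than [p] points, hence meets the other cycle of [g] as well. *)
Lemma automatic_transitivity (G : {group 'S_n}) (a g : 'S_n) : a \in G -> g \in G ->
  a \in cycle_class n mu -> g \in cycle_class n [:: p; (n - p)%N] ->
  [transitive G, on [set: 'I_n] | 'P].
Proof.
move=> aG gG; rewrite !inE => ha hg.
have orbit_porbit b y : b \in G -> porbit b y \subset orbit 'P G y.
  move=> bG; apply/subsetP=> z /porbitP[i ->]; apply/orbitP.
  by exists (b ^+ i)%g => //; apply: groupX.
have [A /imsetP[y _ eA] cA] : exists2 A, A \in porbits g & #|A| = p.
  have : p \in [seq #|C| | C : {set 'I_n} in porbits g] by rewrite (perm_mem hg) mem_head.
  by case/mapP => A; rewrite mem_enum => hA ->; exists A.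
have two_cycle_prim : #|porbits g| = 2%N by have := perm_size hg; rewrite size_map -cardE.
have big : (p < #|orbit 'P G y|)%N.
  have : #|porbit a y| \in mu.
    by rewrite -(perm_mem ha); apply/mapP; exists (porbit a y); rewrite // mem_enum; apply: imset_f.
  by move/hmup; rewrite addn1 => /leq_trans; apply; apply: subset_leq_card; apply: orbit_porbit.
have [z zO zA] : exists2 z, z \in orbit 'P G y & z \notin A.
  apply/subsetPn; apply: contraTN big => /subset_leq_card; by rewrite cA -leqNgt.
apply/imsetP; exists y => //; apply/eqP; rewrite eq_sym eqEsubset subsetT /=.
apply/subsetP => w _; apply: contraT => wO.
have wA : w \notin A by apply: contra wO => wA; apply: (subsetP (orbit_porbit g y gG)); rewrite -eA.
have wz : w \notin porbit g z.
  apply: contra wO => wz; rewrite -(orbit_eqP zO).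
  by apply: (subsetP (orbit_porbit g z gG)).
have : (#|[set A; porbit g z; porbit g w]| <= 2)%N.
  rewrite -two_cycle_prim; apply: subset_leq_card; apply/subsetP => C.
  by rewrite !inE => /orP[/orP[]|] /eqP->; rewrite ?eA imset_f.
rewrite -setUA cardsU1 cards2 !inE.
have -> : (A == porbit g z) = false by apply: contraNF zA => /eqP->; exact: porbit_id.
have -> : (A == porbit g w) = false by apply: contraNF wA => /eqP->; exact: porbit_id.
by have -> : (porbit g z == porbit g w) = false by apply: contraNF wz => /eqP->; exact: porbit_id.
Qed.
End Transitive.

Section PolynomialFormula.
Variables (n p : nat) (mu : seq nat).
Hypothesis hp : (0 < p)%N.
Hypothesis hpn : (p <= n - p)%N.
Hypothesis hmu : is_partition n mu.
Hypothesis hmup : forall m : nat, m \in mu -> (p + 1 <= m)%N.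

Lemma class_nonempty la : all (leq 1) la -> sumn la = n -> (#|cycle_class n la|%:R : rat) != 0.
Proof.
move=> l1 ln; have [||a [L dL eL]] := @exists_type 'I_n la [set: 'I_n] => //.
  by rewrite ln cardsT card_ord.
rewrite pnatr_eq0 -lt0n card_gt0; apply/set0Pn; exists a.
by rewrite inE -eL; apply: cycle_list_type.
Qed.

Lemma class_sum_calV gamma x : x != 0 -> gamma \in cycle_class n [:: p; (n - p)%N] ->
  'C(n, p)%:R * (\sum_(a in cycle_class n mu) x ^+ ncycles (a * gamma)%g) =
  #|cycle_class n mu|%:R * (fps_mul (calV {poly rat} mu)
     (fun m => \sum_(0 <= i < p) binom_shift i%:Z p * pow_shift (i%:Z - p%:Z) m) (n - p)%N).[x].
Proof.
move=> x0 hg.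
have hm : all (leq p.+1) mu by apply/allP => m /hmup; rewrite addn1.
case: p hp hpn hm hg => // q _ qn hm hg.
case E : (n - q.+1)%N qn hg => [|m] // _ hg.
have en : n = (q.+1 + m.+1)%N by lia.
rewrite -two_cycle_coef_calV // -(@class_sum n x q m mu gamma) //; congr (_%:R * _).
by rewrite -bin_sub; [rewrite -E|lia].
Qed.

Lemma P_connE gamma : gamma \in cycle_class n [:: p; (n - p)%N] ->
  P_conn gamma mu = (#|cycle_class n mu|%:R)^-1 *:
    \sum_(a in cycle_class n mu) 'X^(ncycles (a * gamma)%g).
Proof.
move=> hg; congr (_ *: _); apply: eq_bigl => a; case ha: (a \in _) => //=.
by apply: (automatic_transitivity hmup) ha hg; apply: mem_gen; rewrite !inE eqxx ?orbT.
Qed.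

Lemma class_mu_neq0 : (#|cycle_class n mu|%:R : rat) != 0.
Proof. by case/and3P: hmu => _ h1 /eqP; apply: class_nonempty. Qed.

Lemma P_conn_formula gamma : gamma \in cycle_class n [:: p; (n - p)%N] ->
     'C(n, p)%:R *: P_conn gamma mu
     = fps_mul (calV {poly rat} mu)
         (fun m => \sum_(0 <= i < p)
                     binom_shift i%:Z p * pow_shift (i%:Z - p%:Z) m)
         (n - p)%N.
Proof.
move=> hg; apply: poly_eq_nonzero => x x0.
rewrite hornerZ (P_connE hg) hornerZ mulrCA horner_sum.
under eq_bigr do rewrite hornerXn.
by rewrite (class_sum_calV x0 hg) mulKf ?class_mu_neq0.
Qed.
End PolynomialFormula.

(** * Stirling numbers as coefficients *)

Section Stirling.
Variable T : finType.
Implicit Types (g s : {perm T}) (N : {set T}) (o : T).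

(** A permutation is determined by the image of a point and by what remains after deleting
    that point. *)
Lemma perm_on_excise N o s : o \in N ->
  perm_on N s = (s o \in N) && perm_on (N :\ o) (excise s o).
Proof.
move=> oN; apply/idP/andP => [sN|[so ps]].
  split; first by rewrite perm_closed.
  apply/subsetP => z; rewrite inE => hz; rewrite in_setD1.
  have zo : z != o by apply: contraNneq hz => ->; rewrite excise_o.
  rewrite zo /=; apply: contraR hz => zN; rewrite exciseE // (out_perm sN zN).
  by rewrite (negPf zo).
apply/subsetP => z; rewrite inE => hz; apply: contraR hz => zN.
have zo : z != o by apply: contraNneq zN => ->.
have : excise s o z = z by apply: (out_perm ps); rewrite in_setD1 (negPf zN) andbF.
rewrite exciseE //; case: eqP => [_ e|_ -> //].
by rewrite -e so in zN.
Qed.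

Lemma excise_insert g b o : g o = o -> excise (g * tperm b o)%g o = g.
Proof. by move=> go; rewrite /excise permM go tpermR -mulgA tperm2 mulg1. Qed.

(** Building a permutation by inserting one point at a time, the new point either is a fixed
    point, with weight [x], or follows one of the [j] earlier points. *)
Lemma sum_weight_perm_on x N : x != 0 ->
  \sum_(s | perm_on N s) weight x N s = \prod_(j < #|N|) (x + j%:R).
Proof.
move=> x0; elim: {N}_.+1 {-2}N (ltnSn #|N|) => // n IH N.
have [->|[o oN]] := set_0Vmem N.
  move=> _; rewrite cards0 big_ord0 (eq_bigl (pred1 1%g)); last first.
    move=> s; apply/idP/eqP => [h|->]; last exact: perm_on1.
    by apply/permP => z; rewrite perm1 (out_perm h) ?inE.
  by rewrite big_pred1_eq /weight card_porbits1 setC0 cardsT divff // expf_neq0.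
have cN : #|N| = #|N :\ o|.+1 by rewrite (cardsD1 o) oN.
rewrite ltnS => hn; rewrite cN big_ord_recr /=.
rewrite -IH; last by rewrite -cN.
rewrite mulr_suml.
rewrite (reindex_onto (fun q : {perm T} * T => q.1 * tperm q.2 o)%g
   (fun g => (excise g o, g o))) /=; last first.
  by move=> g _; rewrite /excise -mulgA tperm2 mulg1.
transitivity (\sum_(s | perm_on (N :\ o) s) \sum_(b in N) weight x N (s * tperm b o)%g).
  rewrite pair_big_dep; apply: eq_bigl => -[g b] /=.
  apply/andP/andP => [[h /eqP [eg eo]]|[pg bN]].
    move: h; rewrite (perm_on_excise _ oN) eg eo => /andP[-> ->] //.
  have go : g o = o by apply: (out_perm pg); rewrite setD11.
  rewrite (perm_on_excise _ oN) excise_insert // permM go tpermR bN pg; split=> //.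
apply: eq_bigr => s ps.
have so : s o = o by apply: (out_perm ps); rewrite setD11.
rewrite (big_setD1 o) //= tperm1 mulg1 mulrDr (weight_fix x0 _ oN) mulrC; congr (_ + _).
rewrite (eq_bigr (fun=> weight x (N :\ o) s)); last first.
  move=> b; rewrite in_setD1 => /andP[bo _].
  by rewrite (weight_excise x0 oN) ?excise_insert // permM so tpermR.
by rewrite sumr_const mulr_natr.
Qed.

End Stirling.

Lemma sum_ncycles k (x : rat) : x != 0 ->
  \sum_(s : 'S_k) x ^+ ncycles s = \prod_(j < k) (x + j%:R).
Proof.
move=> x0; have := @sum_weight_perm_on 'I_k x [set: 'I_k] x0.
rewrite cardsT card_ord => <-; apply: eq_big => [s|s _].
  by symmetry; apply/subsetP => z _; rewrite inE.
by rewrite /weight setCT cards0 expr0 divr1.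
Qed.

(** The product of the [x - j] is, up to sign, the product of the [x + j] at [-x], whose
    coefficients are the Stirling numbers. *)
Lemma coef_binom_shift0 k r :
  (binom_shift 0 k)`_r = (-1) ^+ (k + r) * (stirling1 k r)%:R / k`!%:R.
Proof.
have E : \prod_(j < k) ('X + 0%:~R - j%:R) =
   \sum_(s : 'S_k) (-1) ^+ k *: ((-1) ^+ ncycles s *: 'X^(ncycles s)) :> {poly rat}.
  apply: poly_eq_nonzero => x x0; rewrite horner_prod horner_sum.
  under [RHS]eq_bigr do rewrite !hornerZ hornerXn -exprMn mulN1r.
  rewrite -mulr_sumr sum_ncycles ?oppr_eq0 // [in RHS](eq_bigr (fun j : 'I_k => - (x - j%:R))).
    rewrite prodrN card_ord signrMK; apply: eq_bigr => j _.
    by rewrite -polyC_natr !hornerE ?addr0.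
  by move=> j _; rewrite opprB addrC.
rewrite /binom_shift E coefZ coef_sum mulrC; congr (_ / _).
rewrite /stirling1 cardsE -sum1_card natr_sum mulr_sumr [RHS]big_mkcond /=.
apply: eq_bigr => s _; rewrite !coefZ coefXn unfold_in eq_sym
  -[eqn _ _]/(_ == _).
by case: eqP => [->|_]; rewrite ?mulr1 ?mulr0 // exprD.
Qed.

Lemma stirling1_small k r : (k < r)%N -> stirling1 k r = 0%N.
Proof.
move=> kr; apply/eqP; rewrite cards_eq0; apply/eqP/setP => s; rewrite !inE.
apply: contraTF kr => /eqP <-; rewrite -leqNgt -{2}(card_ord k).
exact: leq_imset_card.
Qed.

(** * Extracting the coefficient of a given genus *)

Lemma gbin_mul z p a : gbin z p * gbin (z - p%:R) a = 'C(p + a, a)%:R * gbin z (p + a).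
Proof.
elim: a => [|a IH]; first by rewrite gbin0 addn0 bin0 mulr1 mul1r.
rewrite addnS !gbinSr -[X in gbin z p * X]mulrA mulrA IH.
have h : (a.+1%:R * 'C((p + a).+1, a.+1)%:R = (p + a).+1%:R * 'C(p + a, a)%:R :> rat).
  by rewrite -!natrM mul_bin_diag.
have -> : 'C((p + a).+1, a.+1)%:R = (p + a).+1%:R * 'C(p + a, a)%:R / a.+1%:R :> rat.
  by rewrite -h mulrAC mulfV ?mul1r ?natS_neq0.
rewrite natrD; move: (natS_neq0 a) (natS_neq0 (p + a)) => h1 h2.
move: (gbin z (p + a)) ('C(p + a, a)%:R : rat) => B C.
by field; rewrite -natrD !nat1r h1 h2.
Qed.

Lemma sum_gbin_shift x p k :
  \sum_(0 <= i < p) gbin (x + i%:R) k = gbin (x + p%:R) k.+1 - gbin x k.+1.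
Proof.
rewrite (eq_bigr (fun i => gbin (x + i.+1%:R) k.+1 - gbin (x + i%:R) k.+1)).
  by rewrite telescope_sumr // addr0.
by move=> i _; rewrite -natr1 addrA gbin_pascal addrAC subrr add0r.
Qed.

Lemma coef_1X p j : ((1 + 'X : {poly rat}) ^+ p)`_j = 'C(p, j)%:R.
Proof.
rewrite exprDn coef_sum; have [jp|jp] := ltnP j p.+1.
  rewrite (bigD1 (Ordinal jp)) //= big1 ?addr0.
    by rewrite expr1n mul1r coefMn coefXn eqxx.
  move=> i ij; rewrite expr1n mul1r coefMn coefXn.
  by rewrite (_ : (j == i) = false) ?mul0rn //; apply: contraNF ij => /eqP e; apply/eqP/val_inj.
rewrite bin_small // big1 // => i _; rewrite expr1n mul1r coefMn coefXn.
by rewrite gtn_eqF ?mul0rn // (leq_trans (ltn_ord i)).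
Qed.

(** The coefficients of [(1 + y)^p (1 + y)^x = (1 + y)^(x + p)]. *)
Lemma vandermonde x p m : gbin (x + p%:R) m = \sum_(j < m.+1) 'C(p, j)%:R * gbin x (m - j).
Proof.
have : conv 1 (gbin (x + p%:R)) m = gbin (x + p%:R) m.
  rewrite /conv big_ord_recl coef1 mul1r subn0 big1 ?addr0 // => j _.
  by rewrite coef1 mul0r.
by rewrite -conv_Xn mulr1 => <-; apply: eq_bigr => j _; rewrite coef_1X.
Qed.

(** The product of the two binomial coefficients is a constant times a single one, whose sum
    over [i] telescopes; Vandermonde's identity expands the difference, in which the term of
    index 0 cancels. *)
Lemma sum_kernel_gbin x p a :
  \sum_(0 <= i < p) gbin (x + i%:R) p * gbin (x + i%:R - p%:R) a =
  'C(p + a, a)%:R * \sum_(r < (p + a).+1) 'C(p, (p + a).+1 - r)%:R * gbin x r.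
Proof.
under eq_bigr do rewrite gbin_mul.
rewrite -mulr_sumr sum_gbin_shift vandermonde big_ord_recl bin0 mul1r subn0 addrAC subrr add0r.
congr (_ * _); rewrite [RHS](reindex_inj rev_ord_inj) /=; apply: eq_bigr => j _.
by congr ('C(_, _)%:R * gbin _ _); have := ltn_ord j; rewrite /bump /=; lia.
Qed.

(** Each factor [(1 + y)^k - 1] is divisible by [y]. *)
Lemma calV_low mu j : (j < size mu)%N -> calV rat mu j = 0.
Proof.
move=> jd; rewrite /calV.
have [U ->] : exists U : {poly rat}, \prod_(k <- mu) ((1 + 'X) ^+ k - 1) = 'X^(size mu) * U.
  elim: mu {jd} => [|k r [U IH]]; first by exists 1; rewrite big_nil expr0 mul1r.
  exists ((\sum_(i < k) (1 + 'X) ^+ i) * U).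
  by rewrite big_cons IH subrX1 addrAC subrr add0r exprS -!mulrA; congr (_ * _); rewrite mulrCA.
by rewrite coefXnM jd.
Qed.

Section GenusExpansion.
Variables (n p : nat) (mu : seq nat).
Hypothesis hp : (0 < p)%N.
Hypothesis hpn : (p <= n - p)%N.
Hypothesis hmu : is_partition n mu.
Hypothesis hmup : forall m : nat, m \in mu -> (p + 1 <= m)%N.

(** Since [V_mu(y)] is divisible by [y^d], the index [a] in [W] is at most [n - p - d]. *)
Lemma W_high (r : nat) : (n < r + size mu)%N -> W p n mu r = 0.
Proof.
move=> hr; rewrite /W /fps_mul big1 ?mulr0 // => j _.
have [jd|jd] := ltnP j (size mu); first by rewrite calV_low ?mul0r.
by rewrite ifF ?mulr0 //; have := ltn_ord j; lia.
Qed.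

(** The sum over [a] in [W] is the expansion of [sum_kernel_gbin], and the condition on [a]
    in [W] says that [binom(x, r)] occurs in it. *)
Lemma W_expansion :
  fps_mul (calV {poly rat} mu)
         (fun m => \sum_(0 <= i < p)
                     binom_shift i%:Z p * pow_shift (i%:Z - p%:Z) m)
         (n - p)%N
  = 'C(n, p)%:R *: \sum_(0 <= r < n.+1) W p n mu r *: binom_shift 0 r.
Proof.
apply: poly_eq_nonzero => x _.
have E : 'C(n, p)%:R * ((p`!%:R * (n - p)`!%:R) / n`!%:R) = 1 :> rat.
  rewrite -natrM mulrA -natrM bin_fact ?divff ?fact_neq0 //; lia.
rewrite hornerZ !horner_sum mulr_sumr.
under [RHS]eq_bigr => r _.
  rewrite hornerZ horner_binom_shift addr0 /W -[X in _ * X]mulrA mulrA E mul1r /fps_mul mulr_suml.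
  over.
rewrite exchange_big; apply: eq_bigr => j _ /=.
rewrite hornerM calV_poly hornerC horner_sum.
under [RHS]eq_bigr do rewrite -mulrA.
rewrite -mulr_sumr; congr (_ * _).
set a := (n - p - j)%N.
transitivity (\sum_(0 <= i < p) gbin (x + i%:R) p * gbin (x + i%:R - p%:R) a).
  apply: eq_bigr => i _; rewrite hornerM /pow_shift !horner_binom_shift.
  by rewrite rmorphB addrA.
rewrite sum_kernel_gbin mulr_sumr.
have an : ((p + a).+1 <= n.+1)%N by rewrite /a; lia.
rewrite [RHS](@big_cat_nat _ _ _ (p + a).+1) //= [X in _ = _ + X]big_nat_cond [X in _ = _ +
  X]big1 ?addr0.
  rewrite big_mkord; apply: eq_bigr => r _; rewrite ifT; last by have := ltn_ord r; lia.
  have -> : p%:Z + a%:Z - r%:Z + 1 = ((p + a).+1 - r)%N :> int by have := ltn_ord r; lia.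
  by rewrite mulrA.
by move=> r /andP[/andP[h _] _]; rewrite ifF ?mul0r //; lia.
Qed.

Lemma sum_class_inv (F : nat -> rat) g :
  \sum_(a in cycle_class n mu) F (ncycles (a^-1 * g)%g) =
  \sum_(a in cycle_class n mu) F (ncycles (a * g)%g).
Proof.
rewrite [RHS](reindex_inj invg_inj) /=.
by apply: eq_bigl => a; rewrite !inE type_inv.
Qed.

(** A map is given by [(alpha, gamma)], with [beta = alpha^-1 gamma]; its genus prescribes
    the number of cycles of [beta]. Replacing [alpha] by its inverse, which has the same
    cycle type, gives the products [alpha gamma], and conjugation makes the count
    independent of [gamma]. *)
Lemma num_mapsE g gamma : gamma \in cycle_class n [:: p; (n - p)%N] ->
  (num_maps g p n mu)%:R = #|cycle_class n [:: p; (n - p)%N]|%:R *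
    \sum_(a in cycle_class n mu)
       ((ncycles (a * gamma)%g)%:Z == n%:Z - (size mu)%:Z - 2 * g%:Z)%:R :> rat.
Proof.
move=> hg; set r := _ - _ - _.
pose f (q : 'S_n * 'S_n) := (q.1, (q.1^-1 * q.2)%g, q.2).
have -> : num_maps g p n mu =
   #|[set q : 'S_n * 'S_n | [&& q.2 \in cycle_class n [:: p; (n - p)%N],
       q.1 \in cycle_class n mu & (ncycles (q.1^-1 * q.2)%g)%:Z == r]]|.
  rewrite -(@card_imset _ _ f) => [|[a b] [c d] [-> _ ->] //].
  apply: eq_card => -[[a b] c]; rewrite inE; apply/idP/imsetP => /=.
    move=> /and4P[/andP[/eqP ec _] gen hc ha].
    have eb : b = (a^-1 * c)%g by rewrite ec mulKg.
    exists (a, c); last by rewrite /f eb.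
    rewrite inE /= hc ha -eb; move: gen.
    have -> : ncycles a = size mu.
      by move: ha; rewrite inE => /perm_size <-; rewrite size_map -cardE.
    have -> : ncycles c = 2%N.
      by move: hc; rewrite inE => /perm_size; rewrite size_map -cardE.
    by rewrite /r => /eqP h; apply/eqP; lia.
  case=> -[a' c']; rewrite inE /= => /and3P[hc ha hb] [-> -> ->].
  rewrite hc ha mulKVg eqxx /= andbT; apply/andP; split.
    apply: (automatic_transitivity hmup) ha hc; first by apply: mem_gen; rewrite !inE eqxx.
    rewrite -[X in X \in _](mulKVg a' c'); apply: groupM; by apply: mem_gen;
      rewrite !inE eqxx ?orbT.
  have -> : ncycles a' = size mu.
    by move: ha; rewrite inE => /perm_size <-; rewrite size_map -cardE.
  have -> : ncycles c' = 2%N.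
    by move: hc; rewrite inE => /perm_size; rewrite size_map -cardE.
  by rewrite (eqP hb) /r; apply/eqP; lia.
rewrite -sum1_card natr_sum.
transitivity (\sum_(c in cycle_class n [:: p; (n - p)%N]) \sum_(a in cycle_class n mu)
   ((ncycles (a^-1 * c)%g)%:Z == r)%:R : rat).
  rewrite exchange_big pair_big_dep [LHS]big_mkcond [RHS]big_mkcond; apply: eq_bigr => -[a c] _ /=.
  by rewrite inE /=; case: (_ \in _); case: (_ \in _) => //=; case: eqP.
rewrite (eq_bigr (fun=> \sum_(a in cycle_class n mu) ((ncycles (a * gamma)%g)%:Z == r)%:R)).
  by rewrite sumr_const mulr_natl.
move=> c hc; rewrite (sum_class_inv (fun k => (k%:Z == r)%:R)).
exact: (sum_class_const mu (fun k => (k%:Z == r)%:R) hc hg).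
Qed.

(** Compare the coefficients of [x^r] in [P_conn_formula], expanded by [W_expansion]. For
    negative [r] both sides vanish. The sum over the binomial index is cut below by the
    vanishing of Stirling numbers and above by [W_high]. *)
Lemma map_count_formula g :
  (let r : int := n%:Z - (size mu)%:Z - 2 * g%:Z in
   (num_maps g p n mu)%:R
     / (#|cycle_class n [:: p; (n - p)%N]|%:R * #|cycle_class n mu|%:R)
   = \sum_(0 <= k < (2 * g).+1)
       (-1) ^+ k * (stirling1z (r + k%:Z) r)%:R / (factz (r + k%:Z))%:R
         * W p n mu (r + k%:Z) :> rat).
Proof.
move=> r.
have Cg0 : (#|cycle_class n [:: p; (n - p)%N]|%:R : rat) != 0.
  by apply: class_nonempty; rewrite /= ?andbT; lia.
have [gamma hg] : exists gamma, gamma \in cycle_class n [:: p; (n - p)%N].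
  by move: Cg0; rewrite pnatr_eq0 -lt0n card_gt0 => /set0Pn.
have Cm0 := class_mu_neq0 hmu.
rewrite (num_mapsE _ hg) -/r -mulf_div divff // mul1r.
case er : r => [r0|r0]; last first.
  rewrite big1 ?mul0r; last by move=> a _.
  by rewrite big1 // => k _; rewrite /stirling1z; case: (_ + _) => ?; rewrite mulr0 !mul0r.
have -> : (\sum_(a in cycle_class n mu) ((ncycles (a * gamma)%g)%:Z == r0)%:R)
   / #|cycle_class n mu|%:R = (P_conn gamma mu)`_r0.
  rewrite (P_connE hmup hg) coefZ mulrC coef_sum; congr (_ * _).
  by apply: eq_bigr => a _; rewrite coefXn eq_sym.
have C0 : 'C(n, p)%:R != 0 :> rat by rewrite pnatr_eq0 -lt0n bin_gt0; lia.
have := P_conn_formula hp hpn hmu hmup hg;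
  rewrite W_expansion => /(congr1 (fun q : {poly rat} => q`_r0)).
rewrite !coefZ => /(mulfI C0) ->; rewrite coef_sum.
under eq_bigr do rewrite coefZ coef_binom_shift0.
have rn : (r0 + (2 * g).+1 <= n.+1)%N by rewrite /r in er; lia.
(* Only the indices from r to n - d, that is r + k with k at most 2g, contribute. *)
rewrite (@big_cat_nat _ _ _ r0) //=; last by lia.
rewrite [X in _ + X](@big_cat_nat _ _ _ (r0 + (2 * g).+1)) //=; last by lia.
rewrite big_nat_cond big1 ?add0r => [|i /andP[/andP[_ ir] _]]; last first.
  by rewrite stirling1_small // mulr0 !(mul0r, mulr0).
rewrite [X in _ + X]big_nat_cond [X in _ + X]big1 ?addr0 => [|i /andP[/andP[ir _] _]]; last first.
  by rewrite W_high ?mul0r //; rewrite /r in er; lia.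
rewrite -{1}(add0n r0) big_addn addKn; apply: eq_bigr => k _.
rewrite mulrC -PoszD /stirling1z /factz (addnC r0); congr (_ * _ / _ * _).
by rewrite -addnA addnn -mul2n exprD exprM sqrrN !expr1n mulr1.
Qed.
End GenusExpansion.

Theorem theorem3p5 (n p : nat) (hp : (0 < p)%N) (hpn : (p <= n - p)%N)
    (mu : seq nat) (hmu : is_partition n mu)
    (hmup : forall m : nat, m \in mu -> (p + 1 <= m)%N) (g : nat) :
  (let r : int := n%:Z - (size mu)%:Z - 2 * g%:Z in
   (num_maps g p n mu)%:R
     / (#|cycle_class n [:: p; (n - p)%N]|%:R * #|cycle_class n mu|%:R)
   = \sum_(0 <= k < (2 * g).+1)
       (-1) ^+ k * (stirling1z (r + k%:Z) r)%:R / (factz (r + k%:Z))%:R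
         * W p n mu (r + k%:Z) :> rat)
  /\
  (forall gamma : 'S_n, gamma \in cycle_class n [:: p; (n - p)%N] ->
     'C(n, p)%:R *: P_conn gamma mu
     = fps_mul (calV {poly rat} mu)
         (fun m => \sum_(0 <= i < p)
                     binom_shift i%:Z p * pow_shift (i%:Z - p%:Z) m)
         (n - p)%N).
Proof.
split; first exact: (map_count_formula hp hpn hmu hmup g).
by move=> gamma; exact: (P_conn_formula hp hpn hmu hmup).
Qed.
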